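(* Let $n=2$, with rows $p_1\le p_2$. For every $\mathbf m\in\operatorname{Specm}\Gamma$, the fiber of $\mathbf m$ consists of at most $p_1!$ isomorphism classes of irreducible Gelfand–Tsetlin $W(\pi)$-modules. Moreover, for every irreducible Gelfand–Tsetlin $W(\pi)$-module $V$ and every $\mathbf m\in\operatorname{Specm}\Gamma$, $\dim V(\mathbf m)\le p_1!$.
   Context: $\Bbbk$ is algebraically closed of characteristic $0$. For positive integers $p_1\le p_2$, $W(\pi)$ is the finite $W$-algebra of $\mathfrak{gl}_{p_1+p_2}(\Bbbk)$ for the nilpotent of Jordan type $(p_1,p_2)$. It is the quotient of the shifted Yangian $Y_\pi(\mathfrak{gl}_2)$ by the ideal generated by $d_1^{(r)}$, $r>p_1$. $\Gamma$ is its Gelfand–Tsetlin subalgebra: the subalgebra generated by the centre of the subalgebra $W(p_1)$ (generated by the $d_1^{(r)}$) and the centre of $W(\pi)$. It is a polynomial algebra in $2p_1+p_2$ generators. A finitely generated $W(\pi)$-module $M$ is a Gelfand–Tsetlin module if $M=\bigoplus_{\mathbf m\in\operatorname{Specm}\Gamma}M(\mathbf m)$, where $$M(\mathbf m)=\{x\in M:\mathbf m^kx=0\text{ for some }k\ge0\}.$$ The fiber of $\mathbf m$ is the set of isomorphism classes of irreducible Gelfand–Tsetlin modules $M$ with $M(\mathbf m)\ne0$. *)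

(* Defs.v *)
From HB Require Import structures.
From mathcomp Require Import all_boot all_order all_algebra.
Set Implicit Arguments. Unset Strict Implicit. Unset Printing Implicit Defensive.
Import Order.TTheory GRing.Theory Num.Theory.
Local Open Scope ring_scope.

Section WDefs.
Variable k : fieldType.

Section InAlg.
Variable A : algType k.

Definition comm (x y : A) : A := x * y - y * x.

Definition d0 (d : nat -> A) (t : nat) : A := if t == 0%N then 1 else d t.

(* coefficients of the inverse series  \tilde d(u) = d(u)^{-1},
   d(u) = sum_{r>=0} d^{(r)} u^{-r}, d^{(0)} = 1 :
   \tilde d^{(0)} = 1, \tilde d^{(t)} = - sum_{a=1}^{t} d^{(a)} \tilde d^{(t-a)} *)
Fixpoint dtil_seq (d : nat -> A) (n : nat) : seq A :=
  match n with
  | 0%N => [:: 1]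
  | n'.+1 => let s := dtil_seq d n' in
             rcons s (- \sum_(a < n'.+1) d a.+1 * nth 0 s (n' - a)%N)
  end.
Definition dtil (d : nat -> A) (t : nat) : A := nth 0 (dtil_seq d t) t.

(* Defining relations of W(pi) = Y_pi(gl_2) / (d_1^{(r)}, r > p1), for the
   shift matrix with off-diagonal entries s12, s21 (Brundan-Kleshchev).
   Generators: d1^{(r)}, d2^{(r)} (r > 0), e^{(r)} (r > s12), f^{(r)} (r > s21). *)
Definition W_relations (p1 s12 s21 : nat) (d1 d2 e f : nat -> A) : Prop :=
     (forall r s, (0 < r)%N -> (0 < s)%N ->
          comm (d1 r) (d1 s) = 0 /\ comm (d1 r) (d2 s) = 0
          /\ comm (d2 r) (d2 s) = 0)
  /\ (forall r s, (s12 < r)%N -> (s21 < s)%N ->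
          comm (e r) (f s) =
            - \sum_(t < r + s) dtil d1 t * d0 d2 ((r + s).-1 - t)%N)
  /\ (forall r s, (0 < r)%N -> (s12 < s)%N ->
          comm (d1 r) (e s) = \sum_(t < r) d0 d1 t * e ((r + s).-1 - t)%N
       /\ comm (d2 r) (e s) = - \sum_(t < r) d0 d2 t * e ((r + s).-1 - t)%N)
  /\ (forall r s, (0 < r)%N -> (s21 < s)%N ->
          comm (d1 r) (f s) = - \sum_(t < r) f ((r + s).-1 - t)%N * d0 d1 t
       /\ comm (d2 r) (f s) = \sum_(t < r) f ((r + s).-1 - t)%N * d0 d2 t)
  /\ (forall r s, (s12 < r)%N -> (s12 < s)%N ->
          comm (e r) (e s.+1) - comm (e r.+1) (e s) = e r * e s + e s * e r)
  /\ (forall r s, (s21 < r)%N -> (s21 < s)%N ->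
          comm (f r.+1) (f s) - comm (f r) (f s.+1) = f r * f s + f s * f r)
  /\ (forall r, (p1 < r)%N -> d1 r = 0).

Definition is_subalg (S : A -> Prop) : Prop :=
  [/\ S 0, S 1, (forall x y, S x -> S y -> S (x + y)),
      (forall x y, S x -> S y -> S (x * y))
    & (forall (c : k) x, S x -> S (c *: x))].

Definition gen_subalg (G : A -> Prop) (x : A) : Prop :=
  forall S, is_subalg S -> (forall y, G y -> S y) -> S x.

End InAlg.

Definition is_alg_morph (A B : algType k) (phi : A -> B) : Prop :=
  [/\ (forall x y, phi (x + y) = phi x + phi y),
      (forall x y, phi (x * y) = phi x * phi y),
      phi 1 = 1
    & (forall (c : k) x, phi (c *: x) = c *: phi x)].

Definition is_W_algebra (p1 p2 : nat) (A : algType k) (d1 d2 e f : nat -> A)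
  : Prop :=
  exists s12 s21 : nat, (s12 + s21 = p2 - p1)%N /\
  [/\ W_relations p1 s12 s21 d1 d2 e f,
      (forall x, gen_subalg (fun y => (exists2 r, (0 < r)%N & y = d1 r)
                                  \/ (exists2 r, (0 < r)%N & y = d2 r)
                                  \/ (exists2 r, (s12 < r)%N & y = e r)
                                  \/ (exists2 r, (s21 < r)%N & y = f r)) x)
    & (forall (B : algType k) (d1' d2' e' f' : nat -> B),
         W_relations p1 s12 s21 d1' d2' e' f' ->
         exists phi : A -> B, is_alg_morph phi /\
           [/\ (forall r, (0 < r)%N -> phi (d1 r) = d1' r),
               (forall r, (0 < r)%N -> phi (d2 r) = d2' r),
               (forall r, (s12 < r)%N -> phi (e r) = e' r)
             & (forall r, (s21 < r)%N -> phi (f r) = f' r)])].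

Section GT.
Variable A : algType k.
Variable d1 : nat -> A.

Definition Wp1 : A -> Prop := gen_subalg (fun y => exists2 r, (0 < r)%N & y = d1 r).
Definition centre_Wp1 (x : A) : Prop := Wp1 x /\ forall y, Wp1 y -> x * y = y * x.
Definition centre_W (x : A) : Prop := forall y, x * y = y * x.

Definition Gamma : A -> Prop := gen_subalg (fun y => centre_Wp1 y \/ centre_W y).

Definition is_ideal_Gamma (m : A -> Prop) : Prop :=
  [/\ (forall x, m x -> Gamma x), m 0,
      (forall x y, m x -> m y -> m (x + y))
    & (forall g x, Gamma g -> m x -> m (g * x))].

Definition is_max_ideal_Gamma (m : A -> Prop) : Prop :=
  [/\ is_ideal_Gamma m, ~ m 1
    & forall J, is_ideal_Gamma J -> ~ J 1 -> (forall x, m x -> J x) ->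
                forall x, J x <-> m x].

(* x lies in M(m) : m^kk x = 0 for some kk, i.e. every product of kk
   elements of m annihilates x *)
Definition in_wspace (m : A -> Prop) (M : lmodType A) (x : M) : Prop :=
  exists kk : nat, forall g : 'I_kk -> A, (forall i, m (g i)) ->
    (\prod_(i < kk) g i) *: x = 0.

Definition fin_gen (M : lmodType A) : Prop :=
  exists (n : nat) (g : 'I_n -> M), forall x : M,
    exists a : 'I_n -> A, x = \sum_(i < n) a i *: g i.

Definition is_GT_module (M : lmodType A) : Prop :=
  [/\ fin_gen M,
      (forall x : M, exists (n : nat) (ms : 'I_n -> A -> Prop) (xs : 'I_n -> M),
          [/\ forall i, is_max_ideal_Gamma (ms i),
              forall i, in_wspace (ms i) (xs i)
            & x = \sum_(i < n) xs i])
    &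
      (forall (n : nat) (ms : 'I_n -> A -> Prop) (xs : 'I_n -> M),
          (forall i, is_max_ideal_Gamma (ms i)) ->
          (forall i j, i != j -> ~ (forall a, ms i a <-> ms j a)) ->
          (forall i, in_wspace (ms i) (xs i)) ->
          \sum_(i < n) xs i = 0 -> forall i, xs i = 0)].

Definition is_submodule (M : lmodType A) (S : M -> Prop) : Prop :=
  [/\ S 0, (forall x y, S x -> S y -> S (x + y))
    & (forall (a : A) x, S x -> S (a *: x))].

Definition irreducible_module (M : lmodType A) : Prop :=
  (exists x : M, x != 0) /\
  forall S : M -> Prop, is_submodule S -> (forall x, S x) \/ (forall x, S x -> x = 0).

Definition irr_GT_module (M : lmodType A) : Prop :=
  irreducible_module M /\ is_GT_module M.

Definition isomorphic_modules (M N : lmodType A) : Prop :=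
  exists phi : M -> N, [/\ bijective phi,
    (forall x y, phi (x + y) = phi x + phi y)
  & (forall (a : A) x, phi (a *: x) = a *: phi x)].

Definition k_lin_indep (M : lmodType A) (n : nat) (v : 'I_n -> M) : Prop :=
  forall c : 'I_n -> k, \sum_(i < n) (c i)%:A *: v i = 0 -> forall i, c i = 0.

End GT.
End WDefs.

(* Main.v *)
(* Let a(u) = u^p1 d1(u). On a vector on which a(u) acts by the polynomial a,
   the coefficients of the currents e(u) and f(u) are linear functionals on k[u]
   that vanish on the ideals (a(u+1)) and (a(u)). For a root y
   of a, their values at the generator divided by u+1-y, resp. u-y, have weight
   a(u)(u-y+1)/(u-y), resp. a(u)(u-y-1)/(u-y): one root is shifted by -1,
   resp. +1.

   Let v be killed by m, with a = prod_i (u - x_i), and filter A v by the number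
   of letters e, f. As [e, f] lies in the algebra of the d's, which preserves the
   filtration, e and f commute on the graded module. Shifting x_i down therefore
   yields a vector on which f can no longer shift that root, and modulo that
   vector e can no longer shift it. Hence the coordinates split into those only
   going down and those only going up, and the filtration refines to a flag with
   one-dimensional steps of weights x + n, for distinct n in Z^p1. The weight of
   v itself occurs only when x + n is a permutation of x, so at most p1! times.
   Both claims follow, because vectors of non-isomorphic irreducible modules
   killed by m together generate the direct sum of these modules.

   That m has residue field k follows from generic freeness over k[theta]: for a
   central theta acting on an irreducible module, and for theta = d1^(r) in
   Gamma/m. *)
Require Import Defs.
From Stdlib Require Import Classical ClassicalEpsilon.
From HB Require Import structures.
From mathcomp Require Import all_boot all_order all_algebra all_fingroup ring zify.
From mathcomp Require Import mpoly.
Set Implicit Arguments. Unset Strict Implicit. Unset Printing Implicit Defensive.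
Import Order.TTheory GRing.Theory Num.Theory.
Local Open Scope ring_scope.

(** * Linear identities in modules *)

(** That f loses the root x_i after a downward shift is a gcd argument: on the new vector f vanishes
    on the ideal of its old annihilating polynomial and on the ideal of the new weight, and the
    factor at the old value y of x_i has to drop out of their gcd. This requires that no root
    already closed to f has the value y, which can fail when roots differ by integers and are
    treated in the wrong order. The next root is therefore one for which no root still open in both
    directions lies exactly one below; in characteristic 0 a finite set always has one.

    The commutator [e, f] also involves d2, about which the action of d1 on v says nothing. The
    quantum determinant d1(u) d2(u - 1) is central, hence acts by scalars, and d2 is recovered from
    it and d1 by solving a triangular system.

    Since e and f commute only up to shorter words, the flag is built one degree at a time: a new
    vector is added in a single degree, and the total shift of a label is the degree gained. So
    labels from different degrees never coincide. *)

Section LinearReflection.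
Variables (k : comNzRingType) (M : lmodType k).

Inductive lexpr :=
  | LVar of nat | LZero | LAdd of lexpr & lexpr | LOpp of lexpr
  | LScale of k & lexpr.

Fixpoint leval (env : seq M) (e : lexpr) : M :=
  match e with
  | LVar n => env`_n
  | LZero => 0
  | LAdd e1 e2 => leval env e1 + leval env e2
  | LOpp e1 => - leval env e1
  | LScale c e1 => c *: leval env e1
  end.

Fixpoint lcoef (e : lexpr) (n : nat) : k :=
  match e with
  | LVar m => if eqn m n then 1 else 0
  | LZero => 0
  | LAdd e1 e2 => lcoef e1 n + lcoef e2 n
  | LOpp e1 => - lcoef e1 n
  | LScale c e1 => c * lcoef e1 n
  end.

(** Recursion on the number of atoms, instead of a bounded quantifier, makes this unfold for a
    concrete environment into a finite conjunction of scalar identities, each left to [ring]. *)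
Fixpoint lcoef_eq (e1 e2 : lexpr) (n : nat) : Prop :=
  if n is n'.+1 then lcoef e1 n' = lcoef e2 n' /\ lcoef_eq e1 e2 n' else True.

Lemma levalE env e :
  leval env e = \sum_(i < size env) lcoef e i *: env`_i.
Proof.
elim: e => [m||e1 IH1 e2 IH2|e1 IH1|c e1 IH1] /=; rewrite ?IH1 ?IH2.
- have [hm|hm] := ltnP m (size env).
    rewrite (bigD1 (Ordinal hm)) //= -/(m == m) eqxx scale1r big1 ?addr0 // => i.
    rewrite -val_eqE /= eq_sym -/(m == i) => /negbTE ->.
    by rewrite scale0r.
  rewrite nth_default // big1 // => i _; rewrite -/(m == i).
  by rewrite gtn_eqF ?scale0r // (leq_trans _ hm).
- by rewrite big1 // => i _; rewrite scale0r.
- by rewrite -big_split; apply: eq_bigr => i _; rewrite scalerDl.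
- by rewrite -sumrN; apply: eq_bigr => i _; rewrite scaleNr.
- by rewrite scaler_sumr; apply: eq_bigr => i _; rewrite scalerA.
Qed.

Lemma leval_eq env e1 e2 :
  lcoef_eq e1 e2 (size env) -> leval env e1 = leval env e2.
Proof.
rewrite !levalE => h; apply: eq_bigr => i _; congr (_ *: _).
elim: (size env) i h => [|n IH] [i hi] //= [h1 h2].
move: hi; rewrite ltnS leq_eqVlt => /orP[/eqP -> //|hi].
exact: (IH (Ordinal hi) h2).
Qed.

End LinearReflection.

Ltac lin_find x env :=
  match env with
  | x :: _ => constr:(0%N)
  | _ :: ?l => let n := lin_find x l in constr:(S n)
  end.

Ltac lin_add x env :=
  match env with
  | context [x :: _] => env
  | _ => constr:(x :: env)
  end.

Ltac lin_atoms t env :=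
  lazymatch t with
  | (?a + ?b)%R => let e := lin_atoms a env in lin_atoms b e
  | (- ?a)%R => lin_atoms a env
  | (?c *: ?a)%R => lin_atoms a env
  | (0)%R => env
  | _ => lin_add t env
  end.

Ltac lin_reify k t env :=
  lazymatch t with
  | (?a + ?b)%R => let u := lin_reify k a env in let v := lin_reify k b env in
                   constr:(@LAdd k u v)
  | (- ?a)%R => let u := lin_reify k a env in constr:(@LOpp k u)
  | (?c *: ?a)%R => let u := lin_reify k a env in constr:(@LScale k c u)
  | (0)%R => constr:(@LZero k)
  | _ => let n := lin_find t env in constr:(@LVar k n)
  end.

Ltac lin_leaf t :=
  lazymatch t with
  | (?a + ?b)%R => match goal with
                   | _ => lin_leaf a
                   | _ => lin_leaf b
                   end
  | (- ?a)%R => lin_leaf a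
  | (?c *: ?a)%R => lin_leaf a
  | (0)%R => fail
  | _ => tryif is_var t then fail else (let z := fresh "z" in set z := t)
  end.

(* Proves an equality of linear combinations by comparing the coefficients of
   every atom with [ring]; naming the atoms first identifies those that differ
   only in the inferred algebraic structures. *)
Ltac lin k M :=
  repeat match goal with |- ?x = ?y => first [lin_leaf x | lin_leaf y] end;
  match goal with |- ?x = ?y :> ?T =>
    let e0 := constr:(@nil T) in
    let e1 := lin_atoms x e0 in
    let env := lin_atoms y e1 in
    let u := lin_reify k x env in
    let v := lin_reify k y env in
    change (@leval k M env u = @leval k M env v);
    apply: leval_eq; cbn [lcoef_eq lcoef eqn size]; repeat split; ring
  end.

(** * Generating currents *)

Lemma poly_lin_ind (k : fieldType) (P : {poly k} -> Prop) :
  P 0 -> (forall c g h, P g -> P h -> P (c *: g + h)) ->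
  (forall i, P 'X^i) -> forall g, P g.
Proof.
move=> P0 Plin PX g; rewrite -[g]coefK poly_def.
apply: (big_ind P) => // [u v Pu Pv|i _]; first by rewrite -[u]scale1r; exact: Plin.
by rewrite -[_ *: _]addr0; exact: Plin.
Qed.

Section Subspace.
Variables (k : fieldType) (A : algType k).

Definition subspace (S : A -> Prop) : Prop :=
  S 0 /\ forall c x y, S x -> S y -> S (c *: x + y).

Variable S : A -> Prop.
Hypothesis hS : subspace S.

Lemma subspace0 : S 0. Proof. by case: hS. Qed.

Lemma subspaceD x y : S x -> S y -> S (x + y).
Proof. by move=> Sx Sy; rewrite -[x]scale1r; apply: hS.2. Qed.

Lemma subspaceZ c x : S x -> S (c *: x).
Proof. by move=> Sx; rewrite -[_ *: _]addr0; apply: hS.2 => //; case: hS. Qed.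

Lemma subspaceN x : S x -> S (- x).
Proof. by move=> Sx; rewrite -scaleN1r; apply: subspaceZ. Qed.

Lemma subspaceB x y : S x -> S y -> S (x - y).
Proof. by move=> Sx Sy; apply: subspaceD => //; apply: subspaceN. Qed.

Lemma subspace_sum (I : Type) (r : seq I) (P : pred I) (F : I -> A) :
  (forall i, P i -> S (F i)) -> S (\sum_(i <- r | P i) F i).
Proof. by move=> h; apply: big_ind => //; [exact: subspace0|exact: subspaceD]. Qed.

Lemma subspace_eqr x y : S (x - y) -> S y -> S x.
Proof. by move=> h Sy; rewrite -[x](subrK y); apply: subspaceD. Qed.

End Subspace.

(** * Currents acting on weight vectors *)

Section Current.
Variables (k : fieldType) (A : algType k) (p : nat) (d : nat -> A).
Hypothesis hdp : forall r, (p < r)%N -> d r = 0.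

(* A generating current e(u) (kappa = 1) or f(u) (kappa = -1), encoded as the
   linear map sending 'X^i to its i-th coefficient (for e, in the variable
   u + 1). *)
Record current (kappa : k) (G : {poly k} -> A) : Prop := Current {
  current_lin : forall c g h, G (c *: g + h) = c *: G g + G h;
  current_d : forall r g, d r * G g =
    G g * d r + kappa *: \sum_(t < r) G (g * 'X^(r.-1 - t)) * d t;
  current_x : forall g h,
    G h * G ('X * g) - G ('X * h) * G g - kappa *: (G h * G g) +
    (G g * G ('X * h) - G ('X * g) * G h - kappa *: (G g * G h)) = 0 }.

Variables (kappa : k) (G : {poly k} -> A).
Hypothesis hG : current kappa G.

Lemma currentD g h : G (g + h) = G g + G h.
Proof. by rewrite -[g in LHS]scale1r (current_lin hG) scale1r. Qed.

Lemma current0 : G 0 = 0.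
Proof. by apply: (addIr (G 0)); rewrite -currentD !add0r. Qed.

Lemma currentZ c g : G (c *: g) = c *: G g.
Proof. by rewrite -[_ *: g]addr0 (current_lin hG) current0 addr0. Qed.

Lemma currentB g h : G (g - h) = G g - G h.
Proof. by rewrite currentD -scaleN1r currentZ scaleN1r. Qed.

Lemma current_sum (I : Type) (r : seq I) (P : pred I) (F : I -> {poly k}) :
  G (\sum_(i <- r | P i) F i) = \sum_(i <- r | P i) G (F i).
Proof. exact: (big_morph G currentD current0). Qed.


Lemma current_poly (g h : {poly k}) : (size g <= p.+1)%N ->
  G (g * h) = \sum_(t < p.+1) g`_(p - t) *: G (h * 'X^(p - t)).
Proof.
move=> sg; have eg : g = \sum_(t < p.+1) g`_(p - t) *: 'X^(p - t).
  transitivity (\poly_(i < p.+1) g`_i); last first.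
    rewrite poly_def (reindex_inj rev_ord_inj) /=.
    by apply: eq_bigr => i _; rewrite subSS.
  apply/polyP => i; rewrite coef_poly; case: ltnP => // hi.
  by rewrite nth_default // (leq_trans sg).
rewrite [in LHS]eg mulr_suml current_sum; apply: eq_bigr => i _.
by rewrite -scalerAl currentZ mulrC.
Qed.

(** This is [current_d] at [r = p.+1], where both terms containing [d p.+1] vanish: a linear
    recursion for the current with the d's as coefficients. *)
Lemma current_rec g : kappa != 0 ->
  \sum_(t < p.+1) G (g * 'X^(p - t)) * d t = 0.
Proof.
move=> kn0; apply: (scalerI kn0); rewrite scaler0.
by have /esym := current_d hG p.+1 g; rewrite hdp // mulr0 mul0r add0r.
Qed.

Variables (S0 S1 S2 : A -> Prop).
Hypotheses (hS1 : subspace S1) (hS2 : subspace S2).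
Hypothesis G01 : forall g x, S0 x -> S1 (G g * x).
Hypothesis G12 : forall g x, S1 x -> S2 (G g * x).

(* x has weight a modulo S: the operator-valued polynomial
   sum_r d r 'X^(p - r) acts on x as a. *)
Definition has_weight (S : A -> Prop) (a : {poly k}) (x : A) : Prop :=
  forall r, (r <= p)%N -> S (d r * x - a`_(p - r) *: x).

(** On x the d's in [current_rec] become the coefficients of a, so the left side of the recursion
    turns into [G (a * g) * x]. *)
Lemma weight_kills (a g : {poly k}) x : kappa != 0 -> (size a <= p.+1)%N ->
  has_weight S0 a x -> S1 (G (a * g) * x).
Proof.
move=> kn0 sa wx; rewrite -[_ * x]subr0 -(mul0r x) -(current_rec g kn0).
rewrite current_poly // !mulr_suml -sumrB; apply: (subspace_sum hS1) => t _.
rewrite -scalerAl scalerAr -mulrA -mulrBr -opprB mulrN; apply: (subspaceN hS1).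
by apply: G01; apply: wx; rewrite -ltnS.
Qed.

(** The quotient of the ideal (b) by the ideal ((X - y) b) is the line through b, on which g acts by
    its value at y. *)
Lemma kill_eval (b g : {poly k}) y x : (forall g, S1 (G (('X - y%:P) * b * g) * x)) ->
  S1 (G (b * g) * x - g.[y] *: (G b * x)).
Proof.
move=> kx; have /factor_theorem[q hq] : root (g - g.[y]%:P) y.
  by rewrite rootE hornerD hornerN hornerC subrr.
have -> : G (b * g) * x - g.[y] *: (G b * x) = G (('X - y%:P) * b * q) * x; last exact: kx.
have -> : ('X - y%:P) * b * q = b * g - g.[y] *: b.
  by rewrite mulrC mulrA -hq mulrBl mul_polyC mulrC.
by rewrite currentB currentZ mulrBl scalerAl.
Qed.

(** Synthetic division by X - y: the sums are the successive values of Horner's scheme. The value 0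
    at [r = 0] is again the coefficient of c at p, as c has degree below p. *)
Lemma coef_divXsub (c : {poly k}) (y : k) (r : nat) :
  (size c <= p)%N -> (r <= p)%N ->
  \sum_(t < r) (('X - y%:P) * c)`_(p - t) * y ^+ (r.-1 - t) =
  if r is r'.+1 then c`_(p - r) else 0.
Proof.
move=> sc; elim: r => [|r IH] hr; first by rewrite big_ord0.
rewrite big_ord_recr /= subnn expr0 mulr1.
have -> : \sum_(i < r) (('X - y%:P) * c)`_(p - i) * y ^+ (r - i) =
          y * (if r is r'.+1 then c`_(p - r) else 0).
  rewrite -IH ?(ltnW hr) // mulr_sumr; apply: eq_bigr => i _.
  rewrite mulrCA -exprS; congr (_ * _ ^+ _).
  by case: r i {IH hr} => [[]|r] //= i; rewrite subSn // -ltnS.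
rewrite mulrBl coefB coefXM mul_polyC coefZ subn_eq0 leqNgt hr /= -subnS.
case: r hr {IH} => [|r] hr; last by ring.
by rewrite subn0 (nth_default _ sc); ring.
Qed.

Variables (b c : {poly k}) (y : k) (x : A).
Let a := ('X - y%:P) * c.
Hypothesis sc : (size c <= p)%N.
Hypothesis wx : has_weight S0 a x.
Hypothesis kx : forall g, S1 (G (('X - y%:P) * b * g) * x).

(** Moving [d r] past G creates terms in which [kill_eval] replaces powers of X by powers of y. By
    Horner's scheme they add up to kappa c, and a + kappa c = (X - y + kappa) c. *)
Lemma shift_weight : has_weight S1 (('X - (y - kappa)%:P) * c) (G b * x).
Proof.
move=> r hr.
have h t : (t <= p)%N -> forall g,
    S1 (G (b * g) * (d t * x) - (a`_(p - t) * g.[y]) *: (G b * x)).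
  move=> ht g.
  have -> : G (b * g) * (d t * x) - (a`_(p - t) * g.[y]) *: (G b * x) =
      G (b * g) * (d t * x - a`_(p - t) *: x)
      + a`_(p - t) *: (G (b * g) * x - g.[y] *: (G b * x)).
    by rewrite mulrBr -scalerAr; lin k A.
  apply: (subspaceD hS1); first by apply: G01; apply: wx.
  by apply: (subspaceZ hS1); apply: kill_eval.
rewrite mulrA (current_d hG) mulrDl -scalerAl mulr_suml.
have -> : (('X - (y - kappa)%:P) * c)`_(p - r) =
   a`_(p - r) + kappa * \sum_(t < r) a`_(p - t) * ('X^(r.-1 - t)).[y].
  under eq_bigr => t _ do rewrite hornerXn.
  rewrite coef_divXsub // /a !mulrBl !coefB !mul_polyC !coefZ.
  case: r hr => [|r] hr; last by ring.
  by rewrite subn0 [c`_p]nth_default //; ring.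
set u := G b * d r * x; set v := \sum_(t < r) _ * _; set s := \sum_(t < r) _ * _.
have -> : u + kappa *: s - (a`_(p - r) + kappa * v) *: (G b * x) =
   (u - a`_(p - r) *: (G b * x)) + kappa *: (s - v *: (G b * x)).
  by lin k A.
apply: (subspaceD hS1).
  by have := h r hr 1; rewrite mulr1 hornerC mulr1 mulrA.
apply: (subspaceZ hS1); rewrite /s /v scaler_suml -sumrB.
apply: (subspace_sum hS1) => t _; rewrite -mulrA; apply: h.
by apply: leq_trans hr; apply: ltnW.
Qed.

(** Let W f be the vector in question for g = f. The exchange relation of b and b f, in which
    [kill_eval] evaluates the current applied first, says W f + f(y) W 1 = 0 modulo [S2]. At f = 1
    this is 2 W 1 = 0, so all W f vanish. *)
Lemma shift_kills (g : {poly k}) : 2 != 0 :> k ->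
  S2 (G (('X - (y - kappa)%:P) * b * g) * (G b * x)).
Proof.
move=> two; pose W (f : {poly k}) := G (('X - (y - kappa)%:P) * b * f) * (G b * x).
have key f : S2 (W f + f.[y] *: W 1).
  have ke h := kill_eval h kx.
  have D1 := G12 (b * f) (ke 'X); have D4 := G12 b (ke ('X * f)).
  have D5 := G12 ('X * b) (ke f); have D6 := G12 b (ke f).
  rewrite ?(hornerM, hornerX) in D1 D4.
  have /(congr1 (fun z => z * x)) := current_x hG b (b * f).
  rewrite mul0r !(mulrDl, mulNr) -!scalerAl -!mulrA => X0.
  rewrite -[_ + _]subr0 -[0](oppr0) -X0.
  rewrite !mulrBr -!scalerAr in D1 D4 D5 D6.
  have WE h : W h = G ('X * (b * h)) * (G b * x) - (y - kappa) *: (G (b * h) * (G b * x)).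
    by rewrite /W mulrBl mulrBl currentB mul_polyC -scalerAl currentZ mulrBl scalerAl !mulrA.
  rewrite !WE !mulr1.
  have := subspaceB hS2 (subspaceB hS2 (subspaceD hS2 D1 D4) D5) (subspaceZ hS2 kappa D6).
  have -> : b * ('X * f) = 'X * (b * f) by rewrite mulrCA.
  have -> : b * 'X = 'X * b by rewrite mulrC.
  congr S2; lin k A.
have W1 : S2 (W 1).
  have := key 1; rewrite hornerC scale1r -mulr2n -scaler_nat => h.
  by rewrite -[W 1](scalerK two); apply: (subspaceZ hS2).
rewrite -/(W g); apply: (subspace_eqr hS2) (subspaceZ hS2 (- g.[y]) W1).
by rewrite scaleNr opprK; apply: key.
Qed.

End Current.

(** * Filtration by words and its weights *)

Section Char0.
Variable k : fieldType.
Hypothesis hchar : [pchar k] =i pred0.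

Lemma char0_natr_eq0 n : (n%:R == 0 :> k) = (n == 0%N).
Proof. by have /pcharf0P := hchar. Qed.

Lemma char0_intr_eq0 (n : int) : (n%:~R == 0 :> k) = (n == 0).
Proof.
by case: n => n; rewrite ?NegzE ?rmorphN ?oppr_eq0 /= -pmulrn char0_natr_eq0.
Qed.

Lemma char0_intr_inj : injective (intr : int -> k).
Proof.
by move=> a b /eqP; rewrite -subr_eq0 -rmorphB char0_intr_eq0 subr_eq0 => /eqP.
Qed.

Lemma char0_natr_inj : injective (fun n : nat => n%:R : k).
Proof. by move=> a b e; have [//] := @char0_intr_inj (Posz a) (Posz b) e. Qed.

(** Otherwise v i0, v i0 - 1, v i0 - 2, ... would all be values of v on a finite set, although they
    are distinct in characteristic 0. *)
Lemma char0_no_descent (I : finType) (v : I -> k) (R : {set I}) (i0 : I) :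
  i0 \in R -> exists2 i, i \in R & forall j, j \in R -> v j != v i - 1.
Proof.
move=> iR; have [/existsP[i /andP[hi /forallP h]]|] :=
  boolP [exists i, (i \in R) && [forall j, (j \in R) ==> (v j != v i - 1)]].
  by exists i => // j; exact/implyP.
rewrite negb_exists => /forallP h.
have {}h i : i \in R -> exists2 j, j \in R & v j = v i - 1.
  move=> hi; have := h i; rewrite hi /= negb_forall => /existsP[j].
  by rewrite negb_imply negbK => /andP[hj /eqP]; exists j.
have ch n : exists2 j, j \in R & v j = v i0 - n%:R.
  elim: n => [|n [j /h[j' hj' e] e']]; first by exists i0; rewrite ?subr0.
  by exists j' => //; rewrite e e' -natr1 opprD addrA.
have ch2 n : [exists j, v j == v i0 - n%:R].
  by have [j _ e] := ch n; apply/existsP; exists j; rewrite e.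
pose g (t : 'I_#|I|.+1) := xchoose (existsP (ch2 t)).
have /leq_card : injective g.
  move=> s t e; have /eqP := xchooseP (existsP (ch2 s)).
  have /eqP := xchooseP (existsP (ch2 t)); rewrite -/(g s) -/(g t) e => ->.
  move=> /addrI/oppr_inj/char0_natr_inj e'; exact: val_inj.
by rewrite card_ord ltnn.
Qed.

End Char0.

(** * Weights obtained from x0 by integer shifts of the roots *)

Section Weights.
Variables (k : fieldType) (p : nat) (x0 : 'I_p -> k).

Definition shifted_root (m : {ffun 'I_p -> int}) (i : 'I_p) : k :=
  x0 i + (m i)%:~R.

Definition wpoly (m : {ffun 'I_p -> int}) (B : {set 'I_p}) : {poly k} :=
  \prod_(i in B) ('X - (shifted_root m i)%:P).

Definition shift (m : {ffun 'I_p -> int}) (i : 'I_p) (c : int) :=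
  [ffun j => if j == i then m i + c else m j].

Lemma shifted_root_same m i c :
  shifted_root (shift m i c) i = shifted_root m i + c%:~R.
Proof. by rewrite /shifted_root ffunE eqxx rmorphD addrA. Qed.

Lemma shifted_root_other m i c j :
  j != i -> shifted_root (shift m i c) j = shifted_root m j.
Proof. by move=> /negbTE h; rewrite /shifted_root ffunE h. Qed.

Lemma wpolyD1 m (B : {set _}) i : i \in B ->
  wpoly m B = ('X - (shifted_root m i)%:P) * wpoly m (B :\ i).
Proof. by move=> iB; rewrite /wpoly (big_setD1 i). Qed.

Lemma wpoly_shift_notin m (B : {set _}) i c : i \notin B ->
  wpoly (shift m i c) B = wpoly m B.
Proof.
move=> iB; apply: eq_bigr => j jB; rewrite shifted_root_other //.
by apply: contraNneq iB => <-.
Qed.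

Lemma wpoly_shift m (B : {set _}) i c : i \in B -> wpoly (shift m i c) B =
  ('X - (shifted_root m i + c%:~R)%:P) * wpoly m (B :\ i).
Proof.
move=> iB; rewrite (wpolyD1 _ iB) shifted_root_same wpoly_shift_notin //.
by rewrite in_setD1 eqxx.
Qed.

Lemma wpoly0 m : wpoly m set0 = 1.
Proof. by rewrite /wpoly big_set0. Qed.

Lemma wpolyID m B : wpoly m setT = wpoly m B * wpoly m (~: B).
Proof.
rewrite /wpoly (bigID (mem B)) /=; congr (_ * _); apply: eq_bigl => i.
  by rewrite !inE.
by rewrite !inE.
Qed.

Lemma wpoly_root m (B : {set _}) y : root (wpoly m B) y -> exists2 i, i \in B & y = shifted_root m i.
Proof.
rewrite /wpoly rootE horner_prod => /eqP/eqP; rewrite prodf_seq_eq0.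
case/hasP => i _ /andP[hi]; rewrite hornerXsubC subr_eq0 => /eqP; by exists i.
Qed.

Lemma size_wpoly m B : size (wpoly m B) = #|B|.+1.
Proof.
by rewrite /wpoly -big_enum /= size_prod_XsubC cardE.
Qed.

End Weights.

(** * The flag of weight lines in the filtration by words *)

Section Families.
Variables (k : fieldType) (A : algType k) (p : nat) (d : nat -> A).
Hypothesis hchar : [pchar k] =i pred0.
Hypothesis hdp : forall r, (p < r)%N -> d r = 0.
Variables (E F : {poly k} -> A).
Hypotheses (hE : current d 1 E) (hF : current d (-1) F).
Variable L : A -> Prop.
Hypothesis hL : subspace L.
Hypothesis hLm : forall a x, L x -> L (a * x).

(* words t: the elements of A congruent modulo L to combinations of words
   in the currents of length < t. *)
Inductive words : nat -> A -> Prop :=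
  | words_L t x : L x -> words t x
  | words_1 : words 1 1
  | words_lin t c x y : words t x -> words t y -> words t (c *: x + y)
  | words_S t x : words t x -> words t.+1 x
  | words_E t g x : words t x -> words t.+1 (E g * x)
  | words_F t g x : words t x -> words t.+1 (F g * x).

Hypothesis hEF : forall t g h x, words t x ->
  words t (E g * (F h * x) - F h * (E g * x)).

(** Modulo [words t] in each degree t, such a family is a graded module over the d's, in degree 0,
    and E and F, in degree 1. The spaces [S t] need not increase with t, so a vector can be added in
    one degree without entering the others. *)
Record stable (S : nat -> A -> Prop) : Prop := Stable {
  stable_sub : forall t, subspace (S t);
  stable_d : forall t r x, S t x -> S t (d r * x);
  stable_E : forall t g x, S t x -> S t.+1 (E g * x);
  stable_F : forall t g x, S t x -> S t.+1 (F g * x);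
  stable_words : forall t x, words t x -> S t x }.

Definition gen (S : nat -> A -> Prop) (j : nat) (x : A) (t : nat) (z : A) :=
  forall T, stable T -> (forall t z, S t z -> T t z) -> T j x -> T t z.

Lemma gen_stable S j x : stable (gen S j x).
Proof.
split=> [t|t r z h|t g z h|t g z h|t z h].
- split=> [|c y z hy hz] T hT hS hx; have [T0 Tl] := stable_sub hT t => //.
  by apply: Tl; [exact: hy|exact: hz].
- by move=> T hT hS hx; apply: (stable_d hT); exact: h.
- by move=> T hT hS hx; apply: (stable_E hT); exact: h.
- by move=> T hT hS hx; apply: (stable_F hT); exact: h.
- by move=> T hT _ _; exact: (stable_words hT).
Qed.

Variable x0 : 'I_p -> k.
Local Notation root_ := (shifted_root x0).
Local Notation wpoly := (wpoly x0).

(** The sets [bE] and [bF] hold the coordinates still open to E and to F: modulo S, the functionals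
    [E g * x] and [F g * x] depend on g only modulo [wpoly n bE] and [wpoly n bF]. *)
Record state (S : nat -> A -> Prop) (j : nat) (x : A)
    (n : {ffun 'I_p -> int}) (bE bF : {set 'I_p}) : Prop := State {
  state_words : words j.+1 x;
  state_weight : has_weight p d (S j) (wpoly n setT) x;
  state_E : forall g, S j.+1 (E (wpoly n bE * g) * x);
  state_F : forall g, S j.+1 (F (wpoly n bF * g) * x) }.

(** * One step: the current G shifts the root i by -c, and G' is the opposite current *)

Section Step.
Variables (S : nat -> A -> Prop) (j : nat) (x : A) (n : {ffun 'I_p -> int}).
Hypothesis hS : stable S.
Variables (c : int) (G G' : {poly k} -> A) (bG bG' : {set 'I_p}) (i : 'I_p).
Hypothesis (hc0 : c != 0).
Variable (c' : int).
Hypothesis (hc0' : c' != 0).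
Hypotheses (hG : current d c%:~R G) (hG' : current d c'%:~R G').
Hypothesis SG : forall t g x, S t x -> S t.+1 (G g * x).
Hypothesis SG' : forall t g x, S t x -> S t.+1 (G' g * x).
Hypothesis GG' : forall t g h x, words t x ->
  words t (G g * (G' h * x) - G' h * (G g * x)).
Hypothesis wx : words j.+1 x.
Hypothesis Wx : has_weight p d (S j) (wpoly n setT) x.
Hypothesis kG : forall g, S j.+1 (G (wpoly n bG * g) * x).
Hypothesis kG' : forall g, S j.+1 (G' (wpoly n bG' * g) * x).
Hypothesis iG : i \in bG.
Hypothesis iG' : i \in bG' -> forall j, j \notin bG' -> root_ n j != root_ n i.

Let x' := G (wpoly n (bG :\ i)) * x.
Let n' := shift n i (- c).

Let sub t : subspace (S t) := stable_sub hS t.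

Lemma step_weight : has_weight p d (S j.+1) (wpoly n' setT) x'.
Proof.
rewrite /n' wpoly_shift ?inE // rmorphN; apply: (shift_weight hG (sub j.+1)) => //.
- exact: SG.
- by rewrite size_wpoly setTD cardsC1 card_ord; case: (p) i => [[]|].
- by rewrite -(wpolyD1 x0 n) ?inE.
- by move=> g; rewrite -(wpolyD1 x0 n).
Qed.

Lemma step_kills g : S j.+2 (G (wpoly n' bG * g) * x').
Proof.
rewrite /n' wpoly_shift // rmorphN.
apply: (shift_kills hG (sub j.+2)) => //.
- exact: SG.
- by move=> h; rewrite -(wpolyD1 x0 n).
- by rewrite char0_natr_eq0.
Qed.

(** On x' the current G' vanishes on two ideals: that of [wpoly n bG'], since G and G' commute up to
    shorter words, and that of the new weight, by [weight_kills]. If i is in [bG'], their generators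
    are [wpoly n (bG' :\ i)] times X - y and times R, and [iG'] together with [c != 0] makes these
    two cofactors coprime. *)
Lemma step_kills' g : S j.+2 (G' (wpoly n' (bG' :\ i) * g) * x').
Proof.
have k1 h : S j.+2 (G' (wpoly n bG' * h) * x').
  rewrite -[_ * _](subKr (G (wpoly n (bG :\ i)) * (G' (wpoly n bG' * h) * x))).
  apply: (subspaceB (sub _)); first by apply: SG; apply: kG'.
  by apply: (stable_words hS); apply: words_S; apply: GG'.
have iD : i \notin bG' :\ i by rewrite !inE eqxx.
rewrite /n' wpoly_shift_notin //.
have [ibG'|niG'] := boolP (i \in bG'); last first.
  by rewrite (setDidPl _) // disjoint_sym disjoints1.
have k2 h : S j.+2 (G' (wpoly n' setT * h) * x').
  apply: (weight_kills hdp hG' (sub j.+2) _ _ _ _ step_weight).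
  - exact: SG'.
  - by rewrite char0_intr_eq0.
  - by rewrite size_wpoly cardsT card_ord.
pose y := root_ n i; pose R := ('X - (y - c%:~R)%:P) * wpoly n (~: bG').
have eR : wpoly n' setT = wpoly n (bG' :\ i) * R.
  rewrite /n' wpoly_shift ?inE // rmorphN -/y /R mulrCA; congr (_ * _).
  have /mulfI : ('X - y%:P) != 0 by rewrite polyXsubC_eq0.
  by apply; rewrite mulrA -!(wpolyD1 x0 n) ?inE // -wpolyID.
have Ry : R.[y] != 0.
  rewrite hornerM hornerXsubC subKr mulf_neq0 ?char0_intr_eq0 //.
  rewrite -[_ != 0]/(~~ root _ _); apply/negP => /wpoly_root[l].
  by rewrite inE => /(iG' ibG')/eqP h e; apply: h.
(* Bezout's identity for R and X - y, in the form R(y) = R - q (X - y). *)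
have /factor_theorem[q hq] : root (R - R.[y]%:P) y.
  by rewrite rootE hornerD hornerN hornerC subrr.
have -> : wpoly n (bG' :\ i) * g = R.[y]^-1 *: (wpoly n' setT * g)
    - R.[y]^-1 *: (wpoly n bG' * (q * g)).
  rewrite eR (wpolyD1 x0 n ibG') -scalerBr.
  apply: (canRL (scalerK Ry)); rewrite -mul_polyC.
  have -> : R.[y]%:P = R - q * ('X - y%:P) by rewrite -hq subKr.
  by rewrite -/y; ring.
rewrite (currentB hG') !(currentZ hG') mulrBl -!scalerAl.
by apply: (subspaceB (sub _)); apply: (subspaceZ (sub _)).
Qed.

End Step.

Lemma gen_sub S j x t z : S t z -> gen S j x t z.
Proof. by move=> Sz T _ hS _; exact: hS. Qed.

Lemma gen_self S j x : gen S j x j x.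
Proof. by move=> T _ _. Qed.

(** No operation lowers the degree: the family equal to S below j and to everything from j on is
    stable and contains x in degree j. *)
Lemma gen_lt S j x t z : stable S -> (t < j)%N -> gen S j x t z -> S t z.
Proof.
move=> hS tj /(_ (fun t z => (t < j)%N -> S t z)); apply=> //; last by rewrite ltnn.
split=> [u|u r y h uj|u g y h uj|u g y h uj|u y h uj].
- split=> [_|c y y' hy hy' uj]; first exact: (subspace0 (stable_sub hS u)).
  by apply: (stable_sub hS u).2; [exact: hy|exact: hy'].
- by apply: (stable_d hS); exact: h.
- by apply: (stable_E hS); apply: h; apply: ltnW.
- by apply: (stable_F hS); apply: h; apply: ltnW.
- exact: (stable_words hS).
Qed.

(** A vector x' that x generates may be added first; this cuts the passage from S to [gen S j x]
    into two. *)
Lemma gen_gen S j x j' x' t z : stable S -> gen S j x j' x' ->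
  gen (gen S j' x') j x t z <-> gen S j x t z.
Proof.
move=> hS hx'; split=> h T hT hST hx.
  by apply: h => // u y /(_ T); apply=> //; apply: hx'.
by apply: h => // u y Sy; apply: hST; apply: gen_sub.
Qed.

(** When x is an eigenvector of the d's and is killed by E and F modulo S, adding it enlarges degree
    j by the line through x and changes no other degree. *)
Lemma gen_simple S j x t z : stable S ->
  (forall r, exists c, S j (d r * x - c *: x)) ->
  (forall g, S j.+1 (E g * x)) -> (forall g, S j.+1 (F g * x)) -> words j.+1 x ->
  gen S j x t z <-> exists2 c, S t (z - c *: x) & (t != j -> c = 0).
Proof.
move=> hS dx Ex Fx wx; split; last first.
  case=> c Sz hc T hT hST Tx; have sT := stable_sub hT t.
  apply: (subspace_eqr sT (hST _ _ Sz)); have [->|/hc ->] := eqVneq t j.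
    by apply: (subspaceZ (stable_sub hT _)).
  by rewrite scale0r; apply: (subspace0 sT).
pose T t z := exists2 c, S t (z - c *: x) & (t != j -> c = 0).
move/(_ T); apply; last by exists 1; rewrite ?scale1r ?subrr ?eqxx //; apply: subspace0 (stable_sub hS j).
  split=> [u|u r y [c Sy hc]|u g y [c Sy hc]|u g y [c Sy hc]|u y wy].
  - split=> [|c y y' [e Sy he] [e' Sy' he']].
      by exists 0 => //; rewrite scale0r subr0; apply: subspace0 (stable_sub hS u).
    exists (c * e + e') => [|h]; last by rewrite he // he' // mulr0 addr0.
    have -> : c *: y + y' - (c * e + e') *: x = c *: (y - e *: x) + (y' - e' *: x).
      by lin k A.
    exact: (stable_sub hS u).2.
  - have [uj|uj] := eqVneq u j; last first.
      exists 0 => //; rewrite scale0r subr0; apply: (stable_d hS).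
      by move: Sy; rewrite hc // scale0r subr0.
    have [b Sb] := dx r; exists (c * b); last by rewrite uj eqxx.
    have -> : d r * y - (c * b) *: x = d r * (y - c *: x) + c *: (d r * x - b *: x).
      by rewrite mulrBr -scalerAr; lin k A.
    apply: (subspaceD (stable_sub hS u)); first exact: (stable_d hS).
    by rewrite uj; apply: (subspaceZ (stable_sub hS j)).
  - exists 0 => //; rewrite scale0r subr0 -[y](subrK (c *: x)) mulrDr.
    apply: (subspaceD (stable_sub hS _)); first exact: (stable_E hS).
    rewrite -scalerAr; have [->|/hc ->] := eqVneq u j.
      exact: (subspaceZ (stable_sub hS _)).
    by rewrite scale0r; apply: subspace0 (stable_sub hS _).
  - exists 0 => //; rewrite scale0r subr0 -[y](subrK (c *: x)) mulrDr.
    apply: (subspaceD (stable_sub hS _)); first exact: (stable_F hS).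
    rewrite -scalerAr; have [->|/hc ->] := eqVneq u j.
      exact: (subspaceZ (stable_sub hS _)).
    by rewrite scale0r; apply: subspace0 (stable_sub hS _).
  - by exists 0 => //; rewrite scale0r subr0; apply: (stable_words hS).
by move=> u y Sy; exists 0 => //; rewrite scale0r subr0.
Qed.

(** Two vectors remain to be treated. On x' the coordinate i is lost for F by [step_kills']. Modulo
    x' it is lost for E on x, because by [kill_eval] all values of E on the ideal of
    [wpoly n (bE :\ i)] are multiples of x'. *)
Lemma state_step_E S j x n (bE bF : {set _}) i (x' := E (wpoly n (bE :\ i)) * x) :
  stable S -> state S j x n bE bF -> i \in bE ->
  (i \in bF -> forall l, l \notin bF -> root_ n l != root_ n i) ->
  [/\ state S j.+1 x' (shift n i (-1)) bE (bF :\ i),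
      state (gen S j.+1 x') j x n (bE :\ i) bF & gen S j x j.+1 x'].
Proof.
move=> hS [wx Wx kE kF] iE iF; have sub t := stable_sub hS t; split.
- split; first exact: words_E.
  + exact: (step_weight hS (c := 1) hE (stable_E hS) Wx kE).
  + by move=> g; apply: (step_kills hS (c := 1) hE (stable_E hS)).
  + move=> g; apply: (step_kills' hS (c := 1) (c' := -1) isT isT hE hF (stable_E hS) (stable_F hS) hEF) => //.
- split=> // [r hr|g|g]; try by apply: gen_sub; auto.
  have h := @kill_eval _ _ _ _ _ hE (S j.+1) (wpoly n (bE :\ i)) g (root_ n i) x.
  apply: (subspace_eqr (stable_sub (gen_stable _ _ _) _)).
    by apply: gen_sub; apply: h => e; rewrite -(wpolyD1 x0 n iE).
  by apply: (subspaceZ (stable_sub (gen_stable _ _ _) _)); exact: gen_self.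
- by apply: (stable_E (gen_stable _ _ _)); exact: gen_self.
Qed.

(** As i is already closed to E, nothing has to be removed from [bE], and no coprimality condition
    arises. *)
Lemma state_step_F S j x n (bE bF : {set _}) i (x' := F (wpoly n (bF :\ i)) * x) :
  stable S -> state S j x n bE bF -> i \in bF -> i \notin bE ->
  [/\ state S j.+1 x' (shift n i 1) bE bF,
      state (gen S j.+1 x') j x n bE (bF :\ i) & gen S j x j.+1 x'].
Proof.
move=> hS [wx Wx kE kF] iF iE; have sub t := stable_sub hS t; split.
- split; first exact: words_F.
  + exact: (step_weight hS (c := -1) hF (stable_F hS) Wx kF).
  + move=> g; rewrite -[bE](_ : bE :\ i = bE); last first.
      by apply/setDidPl; rewrite disjoint_sym disjoints1.
    have hFE t g' h y (w : words t y) : words t (F g' * (E h * y) - E h * (F g' * y)).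
      rewrite -opprB -scaleN1r -[_ *: _]addr0; apply: words_lin; first exact: hEF.
      by apply: words_L; apply: subspace0.
    apply: (step_kills' hS (c := -1) (c' := 1) isT isT hF hE (stable_F hS) (stable_E hS) hFE) => //.
    by rewrite (negPf iE).
  + by move=> g; apply: (step_kills hS (c := -1) hF (stable_F hS)).
- split=> // [r hr|g|g]; try by apply: gen_sub; auto.
  have h := @kill_eval _ _ _ _ _ hF (S j.+1) (wpoly n (bF :\ i)) g (root_ n i) x.
  apply: (subspace_eqr (stable_sub (gen_stable _ _ _) _)).
    by apply: gen_sub; apply: h => e; rewrite -(wpolyD1 x0 n iF).
  by apply: (subspaceZ (stable_sub (gen_stable _ _ _) _)); exact: gen_self.
- by apply: (stable_F (gen_stable _ _ _)); exact: gen_self.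
Qed.

Local Notation label := {ffun 'I_p -> int}.

(* A chain of subspaces from U0 to U with one-dimensional steps, each labelled
   by the shift of x0 giving its weight. *)
Inductive flag (U0 : A -> Prop) : (A -> Prop) -> seq label -> Prop :=
  | flag_nil U : (forall z, U z <-> U0 z) -> flag U0 U [::]
  | flag_cons U U' x m ls : flag U0 U ls -> subspace U ->
      (forall r z, U z -> U (d r * z)) -> has_weight p d U (wpoly m setT) x ->
      (forall z, U z -> U' z) -> (forall z, U' z -> exists c, U (z - c *: x)) -> flag U0 U' (m :: ls).

Lemma flag_iff U0 U V ls : flag U0 U ls -> (forall z, V z <-> U z) -> flag U0 V ls.
Proof.
case=> [W hW|W U' x m l hf sW dW wx UU' hU] hV.
  by apply: flag_nil => z; rewrite hV hW.
by apply: (flag_cons hf sW dW wx) => z; [move=> Wz; apply/hV/UU'|move=> /hV/hU].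
Qed.

Lemma flag_cat U0 U V ls ls' :
  flag U0 U ls -> flag U V ls' -> flag U0 V (ls' ++ ls).
Proof.
move=> h h'; elim: h' => [W hW|W U' x m l _ hf sW dW wx UU' hU] /=.
  exact: (flag_iff h).
exact: (flag_cons hf sW dW wx UU' hU).
Qed.

(** The distance of m from n is exactly the number l of shifts, because every coordinate moves in
    one direction only. *)
Definition reach (n : label) (bE bF : {set 'I_p}) (l : nat) (m : label) :=
  [forall i, [|| m i == n i, (i \in bE) && (m i < n i) | (i \in bF) && (n i < m i)]]
  && (\sum_i `|m i - n i|%N == l)%N.

Lemma reach_stepE n (bE bF : {set _}) l m i : i \in bE ->
  reach (shift n i (-1)) bE (bF :\ i) l m ->
  reach n bE bF l.+1 m /\ m i < n i.
Proof.
move=> iE /andP[/forallP h /eqP <-].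
have mi : m i < n i.
  by have := h i; rewrite ffunE eqxx !inE eqxx iE /= orbF; case/orP => [/eqP ->|]; lia.
split=> //; apply/andP; split.
  apply/forallP => j; have [->|ji] := eqVneq j i; first by rewrite iE mi orbT.
  by have := h j; rewrite ffunE (negbTE ji) !inE ji.
rewrite (bigD1 i) //= [in X in _ == X](bigD1 i) //= ffunE eqxx -addSn; apply/eqP.
congr (_ + _)%N; first by move: mi; lia.
by apply: eq_bigr => j /negbTE ji; rewrite ffunE ji.
Qed.

Lemma reach_stepF n (bE bF : {set _}) l m i : i \in bF -> i \notin bE ->
  reach (shift n i 1) bE bF l m -> reach n bE bF l.+1 m /\ n i < m i.
Proof.
move=> iF iE /andP[/forallP h /eqP <-].
have mi : n i < m i.
  by have := h i; rewrite ffunE eqxx (negbTE iE) iF /=; case/orP => [/eqP ->|]; lia.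
split=> //; apply/andP; split.
  apply/forallP => j; have [->|ji] := eqVneq j i; first by rewrite iF mi !orbT.
  by have := h j; rewrite ffunE (negbTE ji).
rewrite (bigD1 i) //= [in X in _ == X](bigD1 i) //= ffunE eqxx -addSn; apply/eqP.
congr (_ + _)%N; first by move: mi; lia.
by apply: eq_bigr => j /negbTE ji; rewrite ffunE ji.
Qed.

Lemma reach_dropE n (bE bF : {set _}) l m i : reach n (bE :\ i) bF l m ->
  reach n bE bF l m /\ n i <= m i.
Proof.
case/andP => /forallP h e; split.
  rewrite /reach e andbT; apply/forallP => j; have := h j; rewrite !inE.
  by case/or3P => [->|/andP[/andP[_ ->] ->]|->]; rewrite ?orbT.
by have := h i; rewrite !inE eqxx /=; case/orP => [/eqP -> //|/andP[_ /ltW]].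
Qed.

Lemma reach_dropF n (bE bF : {set _}) l m i : reach n bE (bF :\ i) l m ->
  reach n bE bF l m /\ m i <= n i.
Proof.
case/andP => /forallP h e; split.
  rewrite /reach e andbT; apply/forallP => j; have := h j; rewrite !inE.
  by case/or3P => [->|->|/andP[/andP[_ ->] ->]]; rewrite ?orbT.
have := h i; rewrite !inE eqxx /= orbF.
by case/orP => [/eqP -> //|/andP[_ /ltW]].
Qed.

Lemma flag_gen_base S j x n l : stable S -> state S j x n set0 set0 ->
  exists ls, [/\ flag (S l) (gen S j x l) ls, uniq ls &
    {in ls, forall m, (j <= l)%N && reach n set0 set0 (l - j) m}].
Proof.
move=> hS [wx Wx kE kF].
have w1 : wpoly n set0 = 1 by exact: wpoly0.
have dx r : exists c, S j (d r * x - c *: x).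
  have [rp|pr] := leqP r p; first by exists (wpoly n setT)`_(p - r); apply: Wx.
  exists 0; rewrite (hdp pr) mul0r scale0r subrr.
  exact: subspace0 (stable_sub hS j).
have hg t z : gen S j x t z <-> exists2 c, S t (z - c *: x) & (t != j -> c = 0).
  apply: gen_simple => // g; first by have := kE g; rewrite w1 mul1r.
  by have := kF g; rewrite w1 mul1r.
have [->|lj] := eqVneq l j.
  exists [:: n]; split=> //.
    apply: (flag_cons (U := S j) (x := x)) => //.
    - exact: flag_nil.
    - exact: (stable_sub hS).
    - exact: (stable_d hS).
    - by move=> z; exact: gen_sub.
    - by move=> z /hg[c Sz _]; exists c.
  move=> m; rewrite inE => /eqP ->; rewrite leqnn subnn /reach /=.
  rewrite big1 ?eqxx ?andbT => [|i _]; last by rewrite subrr.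
  by apply/forallP => i; rewrite eqxx.
exists [::]; split=> //; apply: flag_nil => z; split; last exact: gen_sub.
by case/hg => c; move=> + /(_ lj) c0; rewrite c0 scale0r subr0.
Qed.

(** Induction on D, a bound for the degrees left up to l, and for fixed D on the number N of open
    coordinates. A step with i splits off the part generated by x', one degree higher; modulo it, x
    has one open coordinate less. The two label sets are disjoint: after a downward step, entry i is
    less than [n i] in the first and at least [n i] in the second, and the reverse holds after an
    upward step. The condition on roots is the coprimality needed by [state_step_E]. *)
Lemma flag_gen D N S j x n (bE bF : {set _}) l : stable S -> state S j x n bE bF ->
  (forall i i', i \in bE -> i \in bF -> i' \notin bF -> root_ n i' != root_ n i) ->
  (l < j + D)%N -> (#|bE| + #|bF| <= N)%N ->
  exists ls, [/\ flag (S l) (gen S j x l) ls, uniq ls &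
    {in ls, forall m, (j <= l)%N && reach n bE bF (l - j) m}].
Proof.
elim: D N S j x n bE bF => [|D IHD] N S j x n bE bF.
  move=> hS st inv; rewrite addn0 => lj _; exists [::]; split=> //.
  by apply: flag_nil => z; split; [exact: gen_lt|exact: gen_sub].
elim: N S j x n bE bF => [|N IHN] S j x n bE bF hS st inv lj cN.
  move: (cN); rewrite leqn0 addn_eq0 !cards_eq0 => /andP[/eqP eE /eqP eF].
  by subst bE bF; apply: flag_gen_base.
have lj' : (l < j.+1 + D)%N by rewrite addSnnS.
have glue (x' : A) (r1 r2 : pred label) :
    gen S j x j.+1 x' ->
    (forall m, r1 m -> ~~ r2 m) ->
    (forall m, r1 m || r2 m -> (j <= l)%N && reach n bE bF (l - j) m) ->
    (exists ls, [/\ flag (S l) (gen S j.+1 x' l) ls, uniq ls & {in ls, forall m, r1 m}]) ->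
    (exists ls, [/\ flag (gen S j.+1 x' l) (gen (gen S j.+1 x') j x l) ls,
       uniq ls & {in ls, forall m, r2 m}]) ->
    exists ls, [/\ flag (S l) (gen S j x l) ls, uniq ls &
      {in ls, forall m, (j <= l)%N && reach n bE bF (l - j) m}].
  move=> hx' r12 hr [ls1 [f1 u1 h1]] [ls2 [f2 u2 h2]]; exists (ls2 ++ ls1); split.
  - apply: (flag_iff (flag_cat f1 f2)) => z.
    by split=> h; apply/(gen_gen _ _ hS hx').
  - rewrite cat_uniq u1 u2 andbT /=; apply/hasPn => m /h1 /r12.
    by apply: contra => /h2.
  - move=> m; rewrite mem_cat => /orP[/h2 h|/h1 h]; apply: hr; rewrite h //.
    by rewrite orbT.
have stepE i : i \in bE ->
    (i \in bF -> forall l, l \notin bF -> root_ n l != root_ n i) ->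
    (forall i1 i', i1 \in bE -> i1 \in bF :\ i -> i' \notin bF :\ i ->
      root_ (shift n i (-1)) i' != root_ (shift n i (-1)) i1) ->
    exists ls, [/\ flag (S l) (gen S j x l) ls, uniq ls &
      {in ls, forall m, (j <= l)%N && reach n bE bF (l - j) m}].
  move=> iE iF inv'; have [st1 st2 hx'] := state_step_E hS st iE iF.
  apply: (glue _ _ _ hx' _ _ (IHD _ _ _ _ _ _ _ hS st1 inv' lj' (leqnn _))
    (IHN _ _ _ _ _ _ (gen_stable _ _ _) st2 _ lj _)).
  - move=> m /andP[jl /(reach_stepE iE)[_ mi]]; apply/negP.
    by move=> /andP[_ /reach_dropE[_]]; rewrite leNgt mi.
  - move=> m /orP[] /andP[jl].
      move=> /(reach_stepE iE)[h _]; rewrite (ltnW jl) /=.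
      by rewrite -subSn // subSS in h.
    by move=> /reach_dropE[h _]; rewrite jl.
  - by move=> i1 i'; rewrite !inE => /andP[_]; exact: inv.
  - by move: cN; rewrite (cardsD1 i bE) iE addSn ltnS.
(* Coordinates open in both directions come first. The chosen root i has none of them exactly one
   below it, so after the shift, when i is closed to F, the root i differs from every root still
   open in both directions. *)
have [/existsP[i0 hi0]|] := boolP [exists i, i \in bE :&: bF].
  have [i] := char0_no_descent hchar (root_ n) hi0.
  rewrite inE => /andP[iE iF] hi; apply: (stepE i iE).
    by move=> _ l' l'F; exact: inv.
  move=> i1 i' i1E; rewrite !inE => /andP[i1i i1F].
  rewrite (shifted_root_other _ _ _ i1i).
  have [->|i'i] := eqVneq i' i => /= h.
    rewrite shifted_root_same rmorphN /= eq_sym; apply: hi.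
    by rewrite inE i1E.
  by rewrite shifted_root_other //; apply: inv.
rewrite negb_exists => /forallP dis.
have [/existsP[i iE]|] := boolP [exists i, i \in bE].
  have iF : i \notin bF by have := dis i; rewrite inE iE.
  apply: (stepE i iE); first by rewrite (negbTE iF).
  by move=> i1 i' i1E; rewrite !inE; have := dis i1; rewrite inE i1E /= => /negbTE ->; rewrite andbF.
rewrite negb_exists => /forallP nE.
have eE : bE = set0 by apply/setP => i; rewrite inE (negbTE (nE i)).
have [/existsP[i iF]|] := boolP [exists i, i \in bF].
  have [st1 st2 hx'] := state_step_F hS st iF (nE i).
  apply: (glue _ _ _ hx' _ _ (IHD _ _ _ _ _ _ _ hS st1 _ lj' (leqnn _))
    (IHN _ _ _ _ _ _ (gen_stable _ _ _) st2 _ lj _)).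
  - move=> m /andP[jl /(reach_stepF iF (nE i))[_ mi]]; apply/negP.
    by move=> /andP[_ /reach_dropF[_]]; rewrite leNgt mi.
  - move=> m /orP[] /andP[jl].
      move=> /(reach_stepF iF (nE i))[h _]; rewrite (ltnW jl) /=.
      by rewrite -subSn // subSS in h.
    by move=> /reach_dropF[h _]; rewrite jl.
  - by move=> i1 i'; rewrite eE inE.
  - by move=> i1 i'; rewrite eE inE.
  - by move: cN; rewrite (cardsD1 i bF) iF addnCA add1n ltnS.
rewrite negb_exists => /forallP nF.
have eF : bF = set0 by apply/setP => i; rewrite inE (negbTE (nF i)).
by subst bE bF; apply: flag_gen_base.
Qed.

Local Notation weight0 := (wpoly 0 setT).
Hypothesis h1 : has_weight p d L weight0 1.

Lemma words_sub t : subspace (words t).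
Proof. by split=> [|c x y]; [apply: words_L; exact: subspace0|exact: words_lin]. Qed.

Lemma words_d t r x : words t x -> words t (d r * x).
Proof.
move=> h; elim: h r => {t x} [t x Lx||t c x y _ IHx _ IHy|t x _ IH|t g x _ IH|t g x _ IH] r.
- by apply: words_L; apply: hLm.
- have [rp|pr] := leqP r p; last first.
    by rewrite hdp // mul0r; exact: (subspace0 (words_sub 1)).
  apply: (subspace_eqr (words_sub 1) (words_L _ (h1 rp))).
  by apply: (subspaceZ (words_sub 1)); exact: words_1.
- by rewrite mulrDr -scalerAr; apply: words_lin.
- exact: words_S.
- rewrite mulrA (current_d hE) mulrDl -mulrA; apply: (subspaceD (words_sub _)).
    exact: words_E.
  rewrite -scalerAl mulr_suml; apply: (subspaceZ (words_sub _)).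
  by apply: (subspace_sum (words_sub _)) => i _; rewrite -mulrA; apply: words_E.
- rewrite mulrA (current_d hF) mulrDl -mulrA; apply: (subspaceD (words_sub _)).
    exact: words_F.
  rewrite -scalerAl mulr_suml; apply: (subspaceZ (words_sub _)).
  by apply: (subspace_sum (words_sub _)) => i _; rewrite -mulrA; apply: words_F.
Qed.

Lemma words_stable : stable words.
Proof.
split=> // [t|t r x|t g x|t g x]; [exact: words_sub|exact: words_d|exact: words_E|exact: words_F].
Qed.

Lemma words0 x : words 0 x -> L x.
Proof.
move E0: 0%N => t h; elim: h E0 => {t x} // t c x y _ IHx _ IHy e.
by apply: hL.2; [exact: IHx|exact: IHy].
Qed.

(** Over [words] as zero family, the vector 1 in degree 0 generates the whole associated graded
    module, so [flag_gen] describes the step from [words t] to [words t.+1]. *)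
Lemma words_gen t z : gen words 0 1 t z <-> words t.+1 z.
Proof.
split.
  move/(_ (fun t z => words t.+1 z)); apply; last exact: words_1.
    split=> [u|u r x|u g x|u g x|u x]; [exact: words_sub|exact: words_d
      |exact: words_E|exact: words_F|exact: words_S].
  by move=> u x; exact: words_S.
have hg := gen_stable words 0 1.
move=> h; move Eu: t.+1 h => u h.
elim: h t Eu => {u z} [u x Lx||u c x y _ IHx _ IHy|u x wx _|u g x wx IH|u g x wx IH] t e.
- by apply: gen_sub; apply: words_L.
- by case: e => ->; exact: gen_self.
- by apply: (stable_sub hg t).2; [exact: IHx|exact: IHy].
- by case: e => ->; apply: gen_sub.
- case: e => eu; subst u; case: t wx IH => [/words0|t _] Lx IH.
    by apply: gen_sub; apply: words_L; apply: hLm.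
  by apply: (stable_E hg); exact: Lx.
- case: e => eu; subst u; case: t wx IH => [/words0|t _] Lx IH.
    by apply: gen_sub; apply: words_L; apply: hLm.
  by apply: (stable_F hg); exact: Lx.
Qed.

Lemma state_words1 : state words 0 1 0 setT setT.
Proof.
have L0 : has_weight p d (words 0) weight0 1.
  by move=> r rp; apply: words_L; apply: h1.
have sz : (size weight0 <= p.+1)%N by rewrite size_wpoly cardsT card_ord.
split=> // [|g|g]; first exact: words_1.
  apply: (weight_kills hdp hE (words_sub 1) _ _ _ sz L0) => //.
    by move=> g' x; exact: words_E.
  by rewrite oner_eq0.
apply: (weight_kills hdp hF (words_sub 1) _ _ _ sz L0) => //.
  by move=> g' x; exact: words_F.
by rewrite oppr_eq0 oner_eq0.
Qed.

(** The labels entering between [words t] and [words t.+1] have entries with absolute values summing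
    to t, hence are new. *)
Lemma flag_words t : exists ls, [/\ flag L (words t) ls, uniq ls &
  {in ls, forall m : label, \sum_i `|m i|%N < t}%N].
Proof.
elim: t => [|t [ls [f u h]]].
  exists [::]; split=> //; apply: flag_nil => z.
  by split=> [/words0//|]; exact: words_L.
have [ls' [f' u' h']] : exists ls, [/\ flag (words t) (gen words 0 1 t) ls, uniq ls &
    {in ls, forall m, (0 <= t)%N && reach 0 setT setT (t - 0) m}].
  apply: (flag_gen (D := t.+1) words_stable state_words1 _ _ (leqnn _)) => //.
  by move=> i i' _ _; rewrite inE.
have {}h' m : m \in ls' -> (\sum_i `|m i|)%N = t.
  move/h' => /= /andP[_ /eqP]; rewrite subn0 => <-.
  by apply: eq_bigr => i _; rewrite ffunE subr0.
exists (ls' ++ ls); split.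
- by apply: (flag_iff (flag_cat f f')) => z; split=> /words_gen.
- rewrite cat_uniq u' u andbT /=; apply/hasPn => m /h lt; apply/negP => /h' e.
  by rewrite e ltnn in lt.
- move=> m; rewrite mem_cat => /orP[/h' -> //|/h]; exact: ltnW.
Qed.

Definition gen_weight (a : {poly k}) (z : A) : Prop :=
  exists K, forall r, (r <= p)%N -> L ((d r - (a`_(p - r))%:A) ^+ K * z).

Lemma gen_weight_lin a c x y : gen_weight a x -> gen_weight a y ->
  gen_weight a (c *: x + y).
Proof.
move=> [K hK] [K' hK']; exists (K + K')%N => r rp; rewrite mulrDr.
rewrite -scalerAr; apply: hL.2; last by rewrite exprD -mulrA; apply/hLm/hK'.
by rewrite addnC exprD -mulrA; apply/hLm/hK.
Qed.

(** Some [d r] separates a' from a. A high power of [d r] minus its eigenvalue for a kills z, but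
    multiplies x by a nonzero scalar modulo U; hence c x lies in U. *)
Lemma gen_weight_eigen (a a' : {poly k}) U x z c : subspace U ->
  (forall r z, U z -> U (d r * z)) -> (forall z, L z -> U z) ->
  (size a <= p.+1)%N -> (size a' <= p.+1)%N -> a' != a ->
  has_weight p d U a' x -> gen_weight a z -> U (z - c *: x) -> U z.
Proof.
move=> sU dU LU sa sa' aa' wx [K hK] hz.
have [r rp ar] : exists2 r, (r <= p)%N & a'`_(p - r) != a`_(p - r).
  have [/existsP[i hi]|] := boolP [exists i : 'I_p.+1, a'`_i != a`_i].
    by exists (p - i)%N; rewrite ?leq_subr // subKn // -ltnS.
  rewrite negb_exists => /forallP h; case/eqP: aa'; apply/polyP => i.
  have [ip|pi] := ltnP i p.+1; first by have /negPn/eqP := h (Ordinal ip).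
  by rewrite !nth_default // (leq_trans _ pi).
pose y := d r - (a`_(p - r))%:A; pose e := a'`_(p - r) - a`_(p - r).
have yU u : U u -> U (y * u).
  move=> Uu; rewrite mulrBl -scalerAl mul1r; apply: (subspaceB sU); first exact: dU.
  exact: (subspaceZ sU).
have yx n : U (y ^+ n * x - e ^+ n *: x).
  elim: n => [|n IH]; first by rewrite !expr0 mul1r scale1r subrr; apply: subspace0.
  have -> : y ^+ n.+1 * x - e ^+ n.+1 *: x =
      y * (y ^+ n * x - e ^+ n *: x) + e ^+ n *: (d r * x - a'`_(p - r) *: x).
    have -> : d r * x = y * x + a`_(p - r) *: x.
      by rewrite mulrBl -scalerAl mul1r subrK.
    by rewrite !exprS mulrBr -!mulrA -scalerAr /e; lin k A.
  by apply: (subspaceD sU); [exact: yU|apply: (subspaceZ sU); exact: wx].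
have ynU n u : U u -> U (y ^+ n * u).
  by elim: n => [|n IH] Uu; rewrite ?mul1r // exprS -mulrA; apply/yU/IH.
have Ux : c *: x = 0 \/ U x.
  have [->|c0] := eqVneq c 0; first by left; rewrite scale0r.
  right; have e0 : e ^+ K * c != 0 by rewrite mulf_neq0 // expf_neq0 // subr_eq0.
  rewrite -[x](scalerK e0); apply: (subspaceZ sU).
  have -> : (e ^+ K * c) *: x = y ^+ K * z - (y ^+ K * (z - c *: x) +
      c *: (y ^+ K * x - e ^+ K *: x)).
    by rewrite mulrBr -scalerAr; lin k A.
  apply: (subspaceB sU); first by apply: LU; exact: hK.
  by apply: (subspaceD sU); [exact: ynU|exact: (subspaceZ sU)].
apply: (subspace_eqr sU hz); case: Ux => [->|Ux]; first exact: subspace0.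
exact: (subspaceZ sU).
Qed.

Lemma flag_sub U ls : flag L U ls -> forall z, L z -> U z.
Proof.
by elim=> {U ls} [U hU z /hU //|U U' x m ls _ LU _ _ _ UU' _ z /LU]; exact: UU'.
Qed.

(** Induction along the flag. Vectors of generalized weight a already lie below a step of another
    weight; a step of weight a is removed by elimination with a pivot [z i0], which costs one
    vector. *)
Lemma flag_dep U ls (a : {poly k}) : flag L U ls -> (size a <= p.+1)%N ->
  forall n (z : 'I_n -> A), (count (fun m => wpoly m setT == a) ls < n)%N ->
  (forall i, U (z i)) -> (forall i, gen_weight a (z i)) ->
  exists2 c : 'I_n -> k, exists i, c i != 0 & L (\sum_i c i *: z i).
Proof.
move=> h sa; elim: h => {U ls} [U hU|U U' x m ls hf IH sU dU wx _ hU'] n z.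
  move=> n0 Uz _; exists (fun=> 1); first by exists (Ordinal n0); rewrite oner_neq0.
  apply: (subspace_sum hL) => i _; apply: (subspaceZ hL); exact/hU.
move=> hn Uz wz; have LU := flag_sub hf.
have [c hc] := fin_all_exists (fun i => hU' _ (Uz i)).
have [ma|ma] := eqVneq (wpoly m setT) a; last first.
  apply: IH => // [|i]; first by rewrite /= (negbTE ma) in hn.
  by apply: (gen_weight_eigen sU dU LU sa _ ma wx (wz i) (hc i)); rewrite size_wpoly cardsT card_ord.
rewrite /= ma eqxx add1n in hn.
have [/existsP[i0 ci0]|] := boolP [exists i, c i != 0]; last first.
  rewrite negb_exists => /forallP c0; apply: IH => // [|i]; first exact: ltnW.
  by have := hc i; rewrite (eqP (negPn (c0 i))) scale0r subr0.
case: n z hn Uz wz c hc i0 ci0 => [|n] z hn Uz wz c hc i0 ci0; first by case: (i0).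
pose z' j := - (c (lift i0 j) / c i0) *: z i0 + z (lift i0 j).
have Uz' j : U (z' j).
  have -> : z' j = - (c (lift i0 j) / c i0) *: (z i0 - c i0 *: x) +
      (z (lift i0 j) - c (lift i0 j) *: x).
    by rewrite /z' scalerBr scalerA mulNr divfK //; lin k A.
  by apply: sU.2.
have [c' [j0 cj0] Lc'] := IH n z' hn Uz' (fun j => gen_weight_lin _ (wz _) (wz _)).
exists (fun i => if unlift i0 i is Some j then c' j else
    - \sum_j c' j * (c (lift i0 j) / c i0)).
  by exists (lift i0 j0); rewrite liftK.
rewrite (bigD1_ord i0) //= unlift_none.
rewrite [X in _ + X](eq_bigr (fun j => c' j *: z (lift i0 j))); last first.
  by move=> j _; rewrite (@liftK n.+1 i0 j).
suff -> : (- (\sum_j c' j * (c (lift i0 j) / c i0))) *: z i0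
    + \sum_j c' j *: z (lift i0 j) = \sum_j c' j *: z' j by [].
rewrite -sumrN scaler_suml -big_split; apply: eq_bigr => j _ /=.
by rewrite /z'; lin k A.
Qed.

(** Equality of the two products makes the shifted roots a permutation s of x0, and s determines the
    label: m i is the difference of x0 (s i) and x0 i, an integer known from its image in
    characteristic 0. *)
Lemma count_weight0 (ls : seq label) : uniq ls ->
  (count (fun m => wpoly m setT == weight0) ls <= p`!)%N.
Proof.
move=> uls; rewrite -size_filter -card_Sn.
set fs := filter _ _; have ufs : uniq fs by rewrite filter_uniq.
have hs m : m \in fs -> exists s : 'S_p, forall i, root_ m i = x0 (s i).
  rewrite mem_filter => /andP[/eqP e _].
  have e' (n : label) :
      wpoly n setT = \prod_(y <- [tuple root_ n i | i < p]) ('X - y%:P).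
    by rewrite big_map big_enum; apply: eq_bigl => i; rewrite inE.
  move: e; rewrite !e' => /prod_XsubC_eq/tuple_permP[s es]; exists s => i.
  have /(congr1 (fun u => tnth u i)) := val_inj es.
  by rewrite !tnth_mktuple /shifted_root ffunE addr0.
pose F0 m : 'S_p := if [pick s : 'S_p | [forall i, root_ m i == x0 (s i)]] is Some s
  then s else 1%g.
have hF0 m i : m \in fs -> root_ m i = x0 (F0 m i).
  move=> /hs[s es]; rewrite /F0; case: pickP => [s' /forallP/(_ i)/eqP //|/(_ s)].
  by move/negP; case; apply/forallP => l; rewrite es.
rewrite -(size_map F0) cardE uniq_leq_size // => [|s _]; last by rewrite mem_enum.
rewrite map_inj_in_uniq // => m m' hm hm' e; apply/ffunP => i.
have := hF0 m i hm; rewrite e -(hF0 m' i hm') => /addrI.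
exact: char0_intr_inj.
Qed.

Lemma gen_weight_dep n (z : 'I_n -> A) : (p`! < n)%N ->
  (forall i, exists t, words t (z i)) -> (forall i, gen_weight weight0 (z i)) ->
  exists2 c : 'I_n -> k, exists i, c i != 0 & L (\sum_i c i *: z i).
Proof.
move=> hn wz gz; have [T hT] := fin_all_exists wz.
have [ls [f u _]] := flag_words (\max_i T i).
apply: (flag_dep f _ _ _ gz); first by rewrite size_wpoly cardsT card_ord.
  by apply: leq_ltn_trans hn; exact: count_weight0.
move=> i; have := leq_bigmax i (F := T); move: (hT i).
elim: (\max_i T i) => [|M IH] h; first by rewrite leqn0 => /eqP e; rewrite -e.
by rewrite leq_eqVlt => /orP[/eqP <- //|/IH]; move/(_ h); exact: words_S.
Qed.

End Families.

(** * Currents and centre of the W-algebra *)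

Section Modes.
Variables (k : fieldType) (A : algType k).

Definition mode (a : nat -> A) (g : {poly k}) : A :=
  \sum_(i < size g) g`_i *: a i.

Lemma mode_widen a (g : {poly k}) n : (size g <= n)%N -> mode a g = \sum_(i < n) g`_i *: a i.
Proof.
move=> h; rewrite /mode (big_ord_widen n (fun i => g`_i *: a i)) // big_mkcond.
by apply: eq_bigr => i _; case: ltnP => // hi; rewrite nth_default // scale0r.
Qed.

Lemma mode_lin a c g h : mode a (c *: g + h) = c *: mode a g + mode a h.
Proof.
pose n := maxn (size (c *: g + h)) (maxn (size g) (size h)).
have [h1 h2 h3] : [/\ (size (c *: g + h)%R <= n)%N, (size g <= n)%N & (size h <= n)%N].
  by rewrite /n !leq_max !leqnn !orbT.
rewrite (mode_widen a h1) (mode_widen a h2) (mode_widen a h3).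
rewrite scaler_sumr -big_split; apply: eq_bigr => i _ /=.
by rewrite coefD coefZ scalerDl scalerA.
Qed.

Lemma mode_Xn a i : mode a 'X^i = a i.
Proof.
rewrite /mode size_polyXn big_ord_recr /= coefXn eqxx scale1r big1 ?add0r // => j _.
by rewrite coefXn ltn_eqF ?scale0r.
Qed.

Lemma mode0 a : mode a 0 = 0.
Proof. by rewrite /mode size_poly0 big_ord0. Qed.

Lemma modeD a g h : mode a (g + h) = mode a g + mode a h.
Proof. by rewrite -[g in LHS]scale1r mode_lin scale1r. Qed.

Lemma comm_linr (x y z : A) c : comm x (c *: y + z) = c *: comm x y + comm x z.
Proof. by rewrite /comm mulrDr mulrDl -scalerAr -scalerAl; lin k A. Qed.

Lemma exchange_lin_ind (kappa : k) (G : {poly k} -> A) :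
  (forall c g h, G (c *: g + h) = c *: G g + G h) ->
  let ex g h := G h * G ('X * g) - G ('X * h) * G g - kappa *: (G h * G g) in
  (forall i j, ex 'X^i 'X^j + (G 'X^i * G ('X * 'X^j) - G ('X * 'X^i) * G 'X^j
     - kappa *: (G 'X^i * G 'X^j)) = 0) ->
  forall g h, ex g h + ex h g = 0.
Proof.
move=> Glin ex hij; have G0 : G 0 = 0.
  by have := Glin (-1) 0 0; rewrite scaler0 addr0 scaleN1r addNr.
have exl c g g' h : ex (c *: g + g') h = c *: ex g h + ex g' h.
  rewrite /ex mulrDr -scalerAr !Glin !mulrDr -!scalerAr; lin k A.
have exr c g h h' : ex g (c *: h + h') = c *: ex g h + ex g h'.
  rewrite /ex mulrDr -scalerAr !Glin !mulrDl -!scalerAl; lin k A.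
have ex0l h : ex 0 h = 0 by rewrite /ex !mulr0 !G0 !mulr0 scaler0 !subr0.
have ex0r g : ex g 0 = 0 by rewrite /ex !mulr0 !G0 !mul0r scaler0 !subr0.
elim/poly_lin_ind => [h|c g g' IH IH' h|i]; first by rewrite ex0l ex0r addr0.
  by rewrite exl exr addrACA -scalerDr IH IH' scaler0 addr0.
elim/poly_lin_ind => [|c h h' IH IH'|j]; first by rewrite ex0l ex0r addr0.
  by rewrite exl exr addrACA -scalerDr IH IH' scaler0 addr0.
exact: hij.
Qed.

End Modes.

(** * The quantum determinant and the currents of W(pi) *)

Section Relations.
Variables (k : fieldType) (A : algType k) (p1 s12 s21 : nat).
Variables (d1 d2 e f : nat -> A).
Hypothesis hW : W_relations p1 s12 s21 d1 d2 e f.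

Local Notation d := (d0 d1).
Local Notation D := (d0 d2).

Lemma W_d1_trunc r : (p1 < r)%N -> d r = 0.
Proof. by case: r => // r; case: hW => _ [_ [_ [_ [_ [_ h]]]]] /h. Qed.

Lemma W_dd r s : d r * d s = d s * d r.
Proof.
case: r s => [|r] [|s]; rewrite /d0 /= ?mul1r ?mulr1 //.
by case: hW => h _; have [/eqP + _] := h r.+1 s.+1 isT isT; rewrite subr_eq0 => /eqP.
Qed.

Lemma W_dD r s : d r * D s = D s * d r.
Proof.
case: r s => [|r] [|s]; rewrite /d0 /= ?mul1r ?mulr1 //.
by case: hW => h _; have [_ [/eqP + _]] := h r.+1 s.+1 isT isT; rewrite subr_eq0 => /eqP.
Qed.

Lemma W_DD r s : D r * D s = D s * D r.
Proof.
case: r s => [|r] [|s]; rewrite /d0 /= ?mul1r ?mulr1 //.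
by case: hW => h _; have [_ [_ /eqP +]] := h r.+1 s.+1 isT isT; rewrite subr_eq0 => /eqP.
Qed.

Lemma comm1l (x : A) : comm 1 x = 0.
Proof. by rewrite /comm mul1r mulr1 subrr. Qed.

Lemma W_d_e r s : (s12 < s)%N ->
  comm (d r) (e s) = \sum_(t < r) d t * e ((r + s).-1 - t)%N.
Proof.
case: r => [|r] hs; first by rewrite big_ord0 comm1l.
by case: hW => _ [_ [h _]]; have [h1 _] := h r.+1 s isT hs.
Qed.

Lemma W_D_e r s : (s12 < s)%N ->
  comm (D r) (e s) = - \sum_(t < r) D t * e ((r + s).-1 - t)%N.
Proof.
case: r => [|r] hs; first by rewrite big_ord0 oppr0 comm1l.
by case: hW => _ [_ [h _]]; have [_ h1] := h r.+1 s isT hs.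
Qed.

Lemma W_d_f r s : (s21 < s)%N ->
  comm (d r) (f s) = - \sum_(t < r) f ((r + s).-1 - t)%N * d t.
Proof.
case: r => [|r] hs; first by rewrite big_ord0 oppr0 comm1l.
by case: hW => _ [_ [_ [h _]]]; have [h1 _] := h r.+1 s isT hs.
Qed.

Lemma W_D_f r s : (s21 < s)%N ->
  comm (D r) (f s) = \sum_(t < r) f ((r + s).-1 - t)%N * D t.
Proof.
case: r => [|r] hs; first by rewrite big_ord0 comm1l.
by case: hW => _ [_ [_ [h _]]]; have [_ h1] := h r.+1 s isT hs.
Qed.

Lemma W_d_e_step r s : (s12 < s)%N ->
  comm (d r.+1) (e s) = comm (d r) (e s.+1) + d r * e s.
Proof.
move=> hs; rewrite !W_d_e ?(ltnW hs) //; last exact: ltnW.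
by rewrite big_ord_recr /= addnS ?addSn /= addKn.
Qed.

Lemma W_D_e_step r s : (s12 < s)%N ->
  comm (D r.+1) (e s) = comm (D r) (e s.+1) - D r * e s.
Proof.
move=> hs; rewrite !W_D_e //; last exact: ltnW.
by rewrite big_ord_recr /= addnS ?addSn /= addKn opprD.
Qed.

Lemma W_d_f_step r s : (s21 < s)%N ->
  comm (d r.+1) (f s) = comm (d r) (f s.+1) - f s * d r.
Proof.
move=> hs; rewrite !W_d_f //; last exact: ltnW.
by rewrite big_ord_recr /= addnS ?addSn /= addKn opprD.
Qed.

Lemma W_D_f_step r s : (s21 < s)%N ->
  comm (D r.+1) (f s) = comm (D r) (f s.+1) + f s * D r.
Proof.
move=> hs; rewrite !W_D_f //; last exact: ltnW.
by rewrite big_ord_recr /= addnS ?addSn /= addKn.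
Qed.

(* shifted_d2 n is the coefficient of u^-n in d2 (u - 1), and qdet n that of
   d1 (u) d2 (u - 1). *)
Fixpoint binom_d2 (n r : nat) : A :=
  if n is n'.+1 then binom_d2 n' r + binom_d2 n' r.+1 else D r.

Definition shifted_d2 (n : nat) : A := if n is n'.+1 then binom_d2 n' 1 else 1.

Definition qdet (n : nat) : A := \sum_(t < n.+1) d t * shifted_d2 (n - t).

Lemma commDl (x y z : A) : comm (x + y) z = comm x z + comm y z.
Proof. by rewrite /comm mulrDl mulrDr opprD addrACA. Qed.

Lemma commMl (x y z : A) : comm (x * y) z = x * comm y z + comm x z * y.
Proof. by rewrite /comm mulrBr mulrBl !mulrA addrA subrK. Qed.

Lemma comm_suml (I : Type) (r : seq I) (P : pred I) (F : I -> A) z :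
  comm (\sum_(i <- r | P i) F i) z = \sum_(i <- r | P i) comm (F i) z.
Proof.
by apply: (big_morph (fun x => comm x z)) => [x y|]; rewrite ?commDl // /comm mul0r mulr0 subrr.
Qed.

Lemma binom_d2_e_step n r s : (s12 < s)%N ->
  comm (binom_d2 n r.+1) (e s) = comm (binom_d2 n r) (e s.+1) - binom_d2 n r * e s.
Proof.
move=> hs; elim: n r => [|n IH] r /=; first exact: W_D_e_step.
by rewrite !commDl !IH mulrDl; lin k A.
Qed.

Lemma binom_d2_f_step n r s : (s21 < s)%N ->
  comm (binom_d2 n r.+1) (f s) = comm (binom_d2 n r) (f s.+1) + f s * binom_d2 n r.
Proof.
move=> hs; elim: n r => [|n IH] r /=; first exact: W_D_f_step.
by rewrite !commDl !IH mulrDr; lin k A.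
Qed.

(** Passing to u - 1 turns the term [D r * e s] of [W_D_e_step] into [e s * shifted_d2 n], with e on
    the left; in [qdet_e_step] this cancels the term [d r * e s] coming from d1. *)
Lemma shifted_d2_e_step n s : (s12 < s)%N ->
  comm (shifted_d2 n.+1) (e s) = comm (shifted_d2 n) (e s.+1) - e s * shifted_d2 n.
Proof.
move=> hs; case: n => [|n] /=.
  by rewrite W_D_e_step // !comm1l mulr1 mul1r.
by rewrite commDl (binom_d2_e_step n 1) // /comm; lin k A.
Qed.

Lemma shifted_d2_f_step n s : (s21 < s)%N ->
  comm (shifted_d2 n.+1) (f s) = comm (shifted_d2 n) (f s.+1) + shifted_d2 n * f s.
Proof.
move=> hs; case: n => [|n] /=.
  by rewrite W_D_f_step // !comm1l mulr1 mul1r.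
by rewrite commDl (binom_d2_f_step n 1) // /comm; lin k A.
Qed.

Lemma comm_qdet n x : comm (qdet n.+1) x =
  \sum_(t < n.+1) d t * comm (shifted_d2 (n - t).+1) x +
  \sum_(t < n.+1) comm (d t.+1) x * shifted_d2 (n - t).
Proof.
rewrite /qdet comm_suml.
under eq_bigr => t _ do rewrite commMl.
rewrite big_split /=; congr (_ + _).
  rewrite big_ord_recr /= subnn comm1l mulr0 addr0.
  by apply: eq_bigr => t _; rewrite subSn // -ltnS.
by rewrite big_ord_recl /= comm1l mul0r add0r; apply: eq_bigr.
Qed.

Lemma qdet_e_step n s : (s12 < s)%N -> comm (qdet n.+1) (e s) = comm (qdet n) (e s.+1).
Proof.
move=> hs; rewrite comm_qdet /qdet comm_suml -big_split; apply: eq_bigr => t _ /=.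
by rewrite commMl shifted_d2_e_step // W_d_e_step // mulrBr mulrDl !mulrA; lin k A.
Qed.

Lemma qdet_f_step n s : (s21 < s)%N ->
  comm (qdet n.+1) (f s) = comm (qdet n) (f s.+1) + comm (qdet n) (f s).
Proof.
move=> hs; rewrite comm_qdet /qdet !comm_suml -!big_split; apply: eq_bigr => t _ /=.
rewrite shifted_d2_f_step // W_d_f_step // commMl mulrDr mulrBl.
by rewrite /(comm (_ * _) (f s)) !mulrA; lin k A.
Qed.

(** Repeated steps push the commutator down to [qdet 0], which is 1. *)
Lemma qdet_e n s : (s12 < s)%N -> comm (qdet n) (e s) = 0.
Proof.
elim: n s => [|n IH] s hs; last by rewrite qdet_e_step // IH // ltnW.
by rewrite /qdet big_ord1 mul1r comm1l.
Qed.

Lemma qdet_f n s : (s21 < s)%N -> comm (qdet n) (f s) = 0.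
Proof.
elim: n s => [|n IH] s hs; last by rewrite qdet_f_step // !IH ?addr0 // ltnW.
by rewrite /qdet big_ord1 mul1r comm1l.
Qed.

Lemma qdet_comm n x : (forall r, comm (d r) x = 0) -> (forall r, comm (D r) x = 0) ->
  comm (qdet n) x = 0.
Proof.
move=> hd hD; have hb m r : comm (binom_d2 m r) x = 0.
  by elim: m r => [|m IH] r //=; rewrite commDl !IH addr0.
rewrite /qdet comm_suml big1 // => t _; rewrite commMl hd mul0r addr0.
by case: (n - t)%N => [|m] /=; rewrite ?comm1l ?hb mulr0.
Qed.

Hypothesis hgen : forall x, gen_subalg (fun y => (exists2 r, (0 < r)%N & y = d1 r)
                                  \/ (exists2 r, (0 < r)%N & y = d2 r)
                                  \/ (exists2 r, (s12 < r)%N & y = e r)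
                                  \/ (exists2 r, (s21 < r)%N & y = f r)) x.

Lemma comm_eq0 (x y : A) : comm x y = 0 <-> x * y = y * x.
Proof. by rewrite /comm; split=> [/eqP|->]; [rewrite subr_eq0 => /eqP|exact: subrr]. Qed.

Lemma qdet_central n : centre_W (qdet n).
Proof.
move=> y; move: (hgen y) => /(_ (fun y => qdet n * y = y * qdet n)); apply.
  split=> [||x z hx hz|x z hx hz|c x hx]; rewrite ?mulr0 ?mul0r ?mulr1 ?mul1r //.
  - by rewrite mulrDl mulrDr hx hz.
  - by rewrite mulrA hx -mulrA hz mulrA.
  - by rewrite -scalerAl -scalerAr hx.
move=> x [[r r0 ->]|[[r r0 ->]|[[r hr ->]|[r hr ->]]]]; apply/comm_eq0.
- apply: qdet_comm => s; apply/comm_eq0.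
    by have := W_dd s r; rewrite {2 3}/d0; case: r r0.
  by have := W_dD r s; rewrite {1 4}/d0; case: r r0.
- apply: qdet_comm => s; apply/comm_eq0.
    by have := W_dD s r; rewrite {2 3}/d0; case: r r0.
  by have := W_DD s r; rewrite {2 3}/d0; case: r r0.
- exact: qdet_e.
- exact: qdet_f.
Qed.

Local Notation modeE := (mode (fun i => e (s12.+1 + i)%N)).
Local Notation modeF := (mode (fun i => f (s21.+1 + i)%N)).

Lemma modeE_step (DD : nat -> A) (c : k) :
  (forall r s, (s12 < s)%N -> comm (DD r.+1) (e s) = comm (DD r) (e s.+1) + c *: (DD r * e s)) ->
  forall r g, comm (DD r.+1) (modeE g) =
    comm (DD r) (modeE ('X * g)) + c *: (DD r * modeE g).
Proof.
move=> h r; elim/poly_lin_ind => [|b g g' IH IH'|i].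
- by rewrite !mulr0 mode0 !mulr0 scaler0 /comm !mulr0 !mul0r subrr addr0.
- rewrite mulrDr -scalerAr !mode_lin !comm_linr IH IH' mulrDr -scalerAr.
  by lin k A.
- by rewrite -exprS !mode_Xn h ?addnS // ltnS leq_addr.
Qed.

Lemma modeF_step (DD : nat -> A) (c : k) :
  (forall r s, (s21 < s)%N -> comm (DD r.+1) (f s) = comm (DD r) (f s.+1) + c *: (f s * DD r)) ->
  forall r g, comm (DD r.+1) (modeF g) =
    comm (DD r) (modeF ('X * g)) + c *: (modeF g * DD r).
Proof.
move=> h r; elim/poly_lin_ind => [|b g g' IH IH'|i].
- by rewrite !mulr0 mode0 !mul0r scaler0 /comm !mulr0 !mul0r subrr addr0.
- rewrite mulrDr -scalerAr !mode_lin !comm_linr IH IH' mulrDl -scalerAl.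
  by lin k A.
- by rewrite -exprS !mode_Xn h ?addnS // ltnS leq_addr.
Qed.

(** The relations for e have the d's on the left, whereas [current_d] wants them on the right;
    substituting X + 1 performs this reordering. The relations for f have the right form already. *)
Definition currentE (g : {poly k}) : A := modeE (g \Po ('X + 1%:P)).
Definition currentF (g : {poly k}) : A := modeF g.

Lemma currentE_lin c g h : currentE (c *: g + h) = c *: currentE g + currentE h.
Proof. by rewrite /currentE comp_polyD comp_polyZ mode_lin. Qed.

Lemma currentE_X g : currentE ('X * g) = modeE ('X * (g \Po ('X + 1%:P))) + currentE g.
Proof. by rewrite /currentE comp_polyM comp_polyX mulrDl mul1r modeD. Qed.

Lemma currentE_current : current d 1 currentE.
Proof.
split=> [||g h]; first exact: currentE_lin.
  have step r g : comm (d r.+1) (currentE g) =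
      d r * currentE ('X * g) - (currentE ('X * g) - currentE g) * d r.
    rewrite (@modeE_step d 1) => [|r' s hs]; last by rewrite W_d_e_step // scale1r.
    by rewrite currentE_X addrK mulrDr /comm -/(currentE g); lin k A.
  elim=> [|r IH] g.
    by rewrite big_ord0 scaler0 addr0 mul1r mulr1.
  rewrite -[LHS](subrK (currentE g * d r.+1)) -/(comm _ _) step big_ord_recr /=.
  rewrite IH subnn mulr1 !scale1r mulrBl.
  have -> : \sum_(t < r) currentE ('X * g * 'X^(r.-1 - t)) * d t =
      \sum_(t < r) currentE (g * 'X^(r - t)) * d t.
    apply: eq_bigr => t _; congr (currentE _ * _).
    case: r t {IH step} => [[]//|r] t /=.
    by rewrite (mulrC 'X) -mulrA -exprS subSn // -ltnS.
  by lin k A.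
have ex : forall g h,
    modeE h * modeE ('X * g) - modeE ('X * h) * modeE g - (1 : k) *: (modeE h * modeE g) +
    (modeE g * modeE ('X * h) - modeE ('X * g) * modeE h - (1 : k) *: (modeE g * modeE h)) = 0.
  apply: exchange_lin_ind => [c g' h'|i j]; first exact: mode_lin.
  rewrite -!exprS !mode_Xn !addnS !scale1r.
  case: hW => _ [_ [_ [_ [h' _]]]].
  have /eqP := h' (s12.+1 + j)%N (s12.+1 + i)%N (leq_addr _ _) (leq_addr _ _).
  by rewrite -subr_eq0 /comm => /eqP <-; lin k A.
rewrite !currentE_X !mulrDr !mulrDl; rewrite -[RHS](ex (g \Po ('X + 1%:P)) (h \Po ('X + 1%:P))).
by rewrite /currentE; lin k A.
Qed.

Lemma currentF_current : current d (-1) currentF.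
Proof.
split=> [||g h]; first by move=> c g h; exact: mode_lin.
  elim=> [|r IH] g.
    by rewrite big_ord0 scaler0 addr0 mul1r mulr1.
  rewrite -[LHS](subrK (currentF g * d r.+1)) -/(comm _ _) big_ord_recr /=.
  rewrite (@modeF_step d (-1)) => [|r' s hs]; last by rewrite W_d_f_step // scaleN1r.
  rewrite {1}/comm -/(currentF _) IH subnn mulr1.
  have -> : \sum_(t < r) currentF ('X * g * 'X^(r.-1 - t)) * d t =
      \sum_(t < r) currentF (g * 'X^(r - t)) * d t.
    apply: eq_bigr => t _; congr (currentF _ * _).
    case: r t {IH} => [[]//|r] t /=.
    by rewrite (mulrC 'X) -mulrA -exprS subSn // -ltnS.
  by rewrite /currentF; lin k A.
apply: exchange_lin_ind => [c g' h'|i j]; first exact: mode_lin.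
rewrite -!exprS /currentF !mode_Xn !addnS !scaleN1r.
case: hW => _ [_ [_ [_ [_ [h' _]]]]].
have /eqP := h' (s21.+1 + j)%N (s21.+1 + i)%N (leq_addr _ _) (leq_addr _ _).
rewrite -subr_eq0 /comm -oppr_eq0 => /eqP <-; lin k A.
Qed.

Variable L : A -> Prop.
Hypothesis hL : subspace L.
Hypothesis hLm : forall a x, L x -> L (a * x).

Definition scalar_mod (x : A) : Prop := exists c : k, L (x - c%:A).

Lemma scalar_mod_lin c x y : scalar_mod x -> scalar_mod y -> scalar_mod (c *: x + y).
Proof.
move=> [a ha] [b hb]; exists (c * a + b).
have -> : c *: x + y - (c * a + b)%:A = c *: (x - a%:A) + (y - b%:A) by lin k A.
exact: hL.2.
Qed.

Lemma scalar_modM x y : scalar_mod x -> scalar_mod y -> scalar_mod (x * y).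
Proof.
move=> [a ha] [b hb]; exists (b * a).
have -> : x * y - (b * a)%:A = x * (y - b%:A) + b *: (x - a%:A).
  by rewrite mulrBr -scalerAr mulr1; lin k A.
by apply: (subspaceD hL); [exact: hLm|exact: subspaceZ].
Qed.

Lemma scalar_mod0 : scalar_mod 0.
Proof. by exists 0; rewrite scale0r subrr; exact: subspace0. Qed.

Lemma scalar_modB x y : scalar_mod x -> scalar_mod y -> scalar_mod (x - y).
Proof. by move=> hx hy; rewrite addrC -scaleN1r; apply: scalar_mod_lin. Qed.

Lemma scalar_mod_sum n (F : 'I_n -> A) :
  (forall i, scalar_mod (F i)) -> scalar_mod (\sum_i F i).
Proof.
move=> h; apply: (big_ind scalar_mod) => //; first exact: scalar_mod0.
by move=> x y hx hy; rewrite -[x]scale1r; apply: scalar_mod_lin.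
Qed.

Hypothesis hd : forall r, scalar_mod (d r).
Hypothesis hq : forall n, scalar_mod (qdet n).

(** In [qdet n] the term t = 0 is [shifted_d2 n] itself, and all others involve smaller indices: a
    triangular system. *)
Lemma scalar_shifted_d2 n : scalar_mod (shifted_d2 n).
Proof.
elim/ltn_ind: n => n IH; have := hq n; rewrite /qdet big_ord_recl /= mul1r subn0.
rewrite -[shifted_d2 n in X in _ -> X](addrK (\sum_(i < n) d (bump 0 i) * shifted_d2 (n - bump 0 i))).
move=> h; apply: scalar_modB => //; apply: scalar_mod_sum => i.
by apply: scalar_modM => //; apply: IH; rewrite /bump add1n; case: (n) i => [[]//|m] i; rewrite subSS ltnS leq_subr.
Qed.

(** Undoes the expansion of d2(u - 1): the recursion of [binom_d2] expresses index r.+2 by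
    differences of entries with index r.+1, which is why the claim is proved for all n at once. *)
Lemma scalar_D r : scalar_mod (D r).
Proof.
case: r => [|r]; first exact: (hd 0).
suff h n : scalar_mod (binom_d2 n r.+1) by exact: (h 0%N).
elim: r n => [|r IH] n; first exact: (scalar_shifted_d2 n.+1).
have -> : binom_d2 n r.+2 = binom_d2 n.+1 r.+1 - binom_d2 n r.+1.
  by rewrite /= [_ + binom_d2 n r.+2]addrC addrK.
exact: scalar_modB.
Qed.

Lemma size_dtil_seq n : size (dtil_seq d1 n) = n.+1.
Proof. by elim: n => //= n IH; rewrite size_rcons IH. Qed.

Lemma nth_dtil_seq n i : (i <= n)%N -> nth 0 (dtil_seq d1 n) i = dtil d1 i.
Proof.
elim: n => [|n IH]; first by rewrite leqn0 => /eqP ->.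
rewrite leq_eqVlt => /orP[/eqP -> //|]; rewrite ltnS => hi.
by rewrite /= nth_rcons size_dtil_seq ltnS hi IH.
Qed.

Lemma dtilS n : dtil d1 n.+1 = - \sum_(a < n.+1) d1 a.+1 * dtil d1 (n - a).
Proof.
rewrite /dtil /= nth_rcons size_dtil_seq ltnn eqxx; congr (- _).
by apply: eq_bigr => a _; rewrite nth_dtil_seq // leq_subr.
Qed.

Lemma dtil_conv n : \sum_(t < n.+1) d t * dtil d1 (n - t) = (n == 0%N)%:R.
Proof.
case: n => [|n]; first by rewrite big_ord1 mul1r.
by rewrite big_ord_recl /= mul1r subn0 dtilS addNr.
Qed.

Local Notation words := (words currentE currentF L).

Lemma currentE_comp g : modeE g = currentE (g \Po ('X - 1%:P)).
Proof. by rewrite /currentE -comp_polyA comp_polyB comp_polyX comp_polyC addrK comp_polyXr. Qed.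

Lemma words_D t r x : words t x -> words t (D r * x).
Proof.
have sub := words_sub currentE currentF hL.
move=> h; elim: h r => {t x} [t x Lx||t c x y _ IHx _ IHy|t x _ IH|t g x wx IH|t g x wx IH] r.
- by apply: words_L; apply: hLm.
- have [c hc] := scalar_D r; rewrite mulr1; apply: (subspace_eqr (sub 1) (words_L _ _ _ hc)).
  by apply: (subspaceZ (sub 1)); exact: words_1.
- by rewrite mulrDr -scalerAr; apply: words_lin.
- exact: words_S.
- elim: r g => [|r IHr] g; first by rewrite mul1r; apply: words_E.
  have Em u z : words t z -> words t.+1 (modeE u * z).
    by move=> wz; rewrite currentE_comp; apply: words_E.
  have Dm u : words t.+1 (D r * (modeE u * x)).
    by rewrite currentE_comp; apply: IHr.
  rewrite -[currentE g]/(modeE (g \Po ('X + 1%:P))); set u := _ \Po _.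
  rewrite mulrA -[D _ * _](subrK (modeE u * D r.+1)) -/(comm _ _).
  rewrite (@modeE_step D (-1)) => [|r' s hs]; last by rewrite W_D_e_step // scaleN1r.
  rewrite /comm !mulrDl mulNr -scalerAl -!mulrA.
  by do ?[apply: (subspaceD (sub _))|apply: (subspaceN (sub _))|apply: (subspaceZ (sub _))|exact: Dm|apply: Em].
- elim: r g => [|r IHr] g; first by rewrite mul1r; apply: words_F.
  rewrite mulrA -[D _ * _](subrK (currentF g * D r.+1)) -/(comm _ _).
  rewrite (@modeF_step D 1) => [|r' s hs]; last by rewrite W_D_f_step // scale1r.
  rewrite /comm -!/(currentF _) !mulrDl mulNr -scalerAl -!mulrA.
  by do ?[apply: (subspaceD (sub _))|apply: (subspaceN (sub _))|apply: (subspaceZ (sub _))|exact: IHr|apply: words_F].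
Qed.

Lemma words_dtil t n x : (forall t r x, words t x -> words t (d r * x)) ->
  words t x -> words t (dtil d1 n * x).
Proof.
move=> hwd; have sub := words_sub currentE currentF hL.
elim/ltn_ind: n => -[|n] IH wx; first by rewrite mul1r.
rewrite dtilS mulNr mulr_suml; apply: (subspaceN (sub t)).
apply: (subspace_sum (sub t)) => a _; rewrite -mulrA; apply: (hwd t a.+1).
by apply: IH => //; rewrite ltnS leq_subr.
Qed.

Lemma words_EF t g h x : (forall t r x, words t x -> words t (d r * x)) ->
  words t x -> words t (currentE g * (currentF h * x) - currentF h * (currentE g * x)).
Proof.
move=> hwd wx; have sub := words_sub currentE currentF hL.
have -> : currentE g * (currentF h * x) - currentF h * (currentE g * x) =
    comm (currentE g) (currentF h) * x by rewrite /comm mulrBl !mulrA.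
rewrite /currentE; move: (g \Po _) => u; rewrite /currentF /mode.
rewrite comm_suml mulr_suml; apply: (subspace_sum (sub t)) => i _.
have -> : comm (u`_i *: e (s12.+1 + i)%N) (\sum_(j < size h) h`_j *: f (s21.+1 + j)%N) =
  \sum_(j < size h) (u`_i * h`_j) *: comm (e (s12.+1 + i)%N) (f (s21.+1 + j)%N).
  rewrite /comm mulr_sumr mulr_suml -sumrB; apply: eq_bigr => j _.
  by rewrite -!scalerAl -!scalerAr !scalerA scalerBr (mulrC h`_j).
rewrite mulr_suml; apply: (subspace_sum (sub t)) => j _; rewrite -scalerAl.
apply: (subspaceZ (sub t)); case: hW => _ [h' _].
rewrite h' ?leq_addr // mulNr mulr_suml; apply: (subspaceN (sub t)).
apply: (subspace_sum (sub t)) => l _; rewrite -mulrA; apply: words_dtil => //.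
exact: words_D.
Qed.

Lemma words_exhaust x : (forall t r x, words t x -> words t (d r * x)) ->
  exists t, words t x.
Proof.
move=> hwd; have sub := words_sub currentE currentF hL.
have mono t t' y : (t <= t')%N -> words t y -> words t' y.
  by move=> /subnK <-; elim: (t' - t)%N => [//|m IH] wy; apply: words_S; apply: IH.
suff h : forall t y, words t y -> exists u, words u (x * y).
  by have [u] := h 1%N 1 (words_1 _ _ _); rewrite mulr1; exists u.
move: (hgen x) => /(_ (fun x => forall t y, words t y -> exists u, words u (x * y))).
apply.
  split=> [t y wy|t y wy|a b ha hb t y wy|a b ha hb t y wy|c a ha t y wy].
  - by exists t; rewrite mul0r; exact: subspace0.
  - by exists t; rewrite mul1r.
  - have [u wu] := ha t y wy; have [v wv] := hb t y wy.
    exists (maxn u v); rewrite mulrDl; apply: (subspaceD (sub _)).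
      by apply: mono wu; rewrite leq_maxl.
    by apply: mono wv; rewrite leq_maxr.
  - have [u wu] := hb t y wy; have [v wv] := ha u _ wu.
    by exists v; rewrite -mulrA.
  - have [u wu] := ha t y wy; exists u; rewrite -scalerAl.
    exact: (subspaceZ (sub u)).
move=> {x} z [[r r0 ->]|[[r r0 ->]|[[r hr ->]|[r hr ->]]]] t y wy.
- by exists t; have := hwd t r _ wy; rewrite /d0; case: r r0.
- by exists t; have := words_D r wy; rewrite /d0; case: r r0.
- exists t.+1; have -> : e r = modeE 'X^(r - s12.+1) by rewrite mode_Xn subnKC.
  by rewrite currentE_comp; apply: words_E.
- exists t.+1; have -> : f r = currentF 'X^(r - s21.+1).
    by rewrite /currentF mode_Xn subnKC.
  exact: words_F.
Qed.

End Relations.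

(** * The bound p1! for vectors of one generalized weight *)

Section Bound.
Variables (k : closedFieldType) (A : algType k) (p1 s12 s21 : nat).
Hypothesis hchar : [pchar k] =i pred0.
Variables (d1 d2 e f : nat -> A).
Hypothesis hW : W_relations p1 s12 s21 d1 d2 e f.
Hypothesis hgen : forall x, gen_subalg (fun y => (exists2 r, (0 < r)%N & y = d1 r)
                                  \/ (exists2 r, (0 < r)%N & y = d2 r)
                                  \/ (exists2 r, (s12 < r)%N & y = e r)
                                  \/ (exists2 r, (s21 < r)%N & y = f r)) x.
Variable L : A -> Prop.
Hypothesis hL : subspace L.
Hypothesis hLm : forall a x, L x -> L (a * x).
Variable a : nat -> k.
Hypothesis ha : forall r, (0 < r)%N -> L (d1 r - (a r)%:A).
Hypothesis hq : forall n, scalar_mod L (qdet d1 d2 n).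

Theorem gen_weight_bound n (z : 'I_n -> A) : (p1`! < n)%N ->
  (forall i, exists K, forall r, (0 < r)%N -> L ((d1 r - (a r)%:A) ^+ K * z i)) ->
  exists2 c : 'I_n -> k, exists i, c i != 0 & L (\sum_i c i *: z i).
Proof.
move=> hn hz.
(* P is u^p1 d1(u) with every [d1 r] replaced by [a r]; its roots with multiplicity form the base
   point [x0] of all labels. *)
pose P := \poly_(i < p1.+1) (if i == p1 then 1 else a (p1 - i)).
have sP : size P = p1.+1 by rewrite size_poly_eq // eqxx oner_eq0.
have [rs eP] := closed_field_poly_normal P.
have mP : lead_coef P = 1.
  by rewrite lead_coefE sP coef_poly ltnSn eqxx.
rewrite mP scale1r in eP.
have srs : size rs = p1 by apply: succn_inj; rewrite -sP eP size_prod_XsubC.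
pose x0 (i : 'I_p1) := rs`_i.
have wP : wpoly x0 0 setT = P.
  rewrite eP (big_nth 0) srs big_mkord /wpoly; apply: eq_big => i; first by rewrite inE.
  by rewrite /shifted_root ffunE addr0.
have cP r : (0 < r)%N -> (r <= p1)%N -> P`_(p1 - r) = a r.
  by move=> r0 rp; rewrite coef_poly ltnS leq_subr ifN ?subKn //; apply/eqP; lia.
have cP0 : P`_(p1 - 0) = 1 by rewrite subn0 coef_poly ltnSn eqxx.
have hdp r := W_d1_trunc hW (r := r).
have h1 : has_weight p1 (d0 d1) L (wpoly x0 0 setT) 1.
  rewrite wP => -[|r] rp; rewrite mulr1; last by rewrite cP //; apply: ha.
  by rewrite cP0 scale1r subrr; apply: subspace0.
have hE := currentE_current hW; have hF := currentF_current hW.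
have hd r : scalar_mod L (d0 d1 r).
  case: r => [|r]; last by exists (a r.+1); apply: ha.
  by exists 1; rewrite scale1r subrr; apply: subspace0.
have hwd t r x := @words_d _ _ _ _ hdp _ _ hE hF _ hL hLm _ h1 t r x.
apply: (gen_weight_dep hchar hdp hE hF hL hLm _ h1 hn).
- by move=> t g h x; exact: (words_EF hW hL hLm hd hq).
- by move=> i; exact: (words_exhaust hW hgen hL hLm hd hq).
(* The exponent must be positive for r = 0, where the operator raised to it is 1 - 1. *)
- move=> i; have [K hK] := hz i; exists K.+1 => r rp; rewrite wP.
  case: r rp => [|r] rp; last first.
    by rewrite cP // exprS -mulrA; apply: hLm; apply: hK.
  rewrite cP0 scale1r subrr expr0n mul0r; exact: subspace0.
Qed.

End Bound.

(** * Generic freeness *)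

(** Induction on the number j of coordinates compared. If G works for j, it also covers the
    exponents whose next coordinate is at least the maximum over G. Below the maximum that
    coordinate has finitely many values, and each slice is again a problem with j coordinates. *)
Lemma dickson (m : nat) (P : 'X_{1..m} -> Prop) :
  exists2 G : seq 'X_{1..m}, {in G, forall g, P g} &
    forall a, P a -> exists2 g, g \in G & (g <= a)%MM.
Proof.
suff H : forall j, (j <= m)%N -> forall P : 'X_{1..m} -> Prop,
    exists2 G : seq 'X_{1..m}, {in G, forall g, P g} &
    forall a, P a -> exists2 g, g \in G & forall i : 'I_m, (i < j)%N -> (g i <= a i)%N.
  have [G GP Gd] := H m (leqnn m) P; exists G => // a /Gd[g gG h].
  by exists g => //; apply/mnm_lepP => i; apply: h.
elim=> [|j IH] jm {}P.
  have [[a Pa]|nP] := classic (exists a, P a).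
    by exists [:: a] => [g|b _]; [rewrite inE => /eqP ->|exists a; rewrite ?inE].
  by exists [::] => // a Pa; case: nP; exists a.
have [G GP Gd] := IH (ltnW jm) P; pose l := Ordinal jm.
have [H HP Hd] : exists2 H : seq 'X_{1..m}, {in H, forall g, P g} &
    forall a, P a -> (a l < \max_(g <- G) g l)%N ->
      exists2 g, g \in H & forall i : 'I_m, (i < j.+1)%N -> (g i <= a i)%N.
  elim: (\max_(g <- G) g l) => [|M [H HP Hd]]; first by exists [::].
  have [H' HP' Hd'] := IH (ltnW jm) (fun a => P a /\ a l = M).
  exists (H ++ H') => [g|a Pa]; first by rewrite mem_cat => /orP[/HP|/HP'[]].
  rewrite ltnS leq_eqVlt => /orP[/eqP aM|/(Hd _ Pa)[g gH h]]; last first.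
    by exists g => //; rewrite mem_cat gH.
  have [g gH h] := Hd' a (conj Pa aM); exists g; first by rewrite mem_cat gH orbT.
  move=> i; rewrite ltnS leq_eqVlt => /orP[/eqP ij|]; last exact: h.
  by have -> : i = l by [exact: val_inj]; have [_ ->] := HP' _ gH; rewrite aM.
exists (G ++ H) => [g|a Pa]; first by rewrite mem_cat => /orP[/GP|/HP].
have [lt|ge] := ltnP (a l) (\max_(g <- G) g l).
  by have [g gH h] := Hd a Pa lt; exists g; rewrite // mem_cat gH orbT.
have [g gG h] := Gd a Pa; exists g; first by rewrite mem_cat gG.
move=> i; rewrite ltnS leq_eqVlt => /orP[/eqP ij|]; last exact: h.
have -> : i = l by exact: val_inj.
by apply: leq_trans ge; exact: (@leq_bigmax_seq _ G xpredT (fun g : 'X_{1..m} => g l)).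
Qed.

(** * Ordered monomials with coefficients in k[theta] *)

Section Freeness.
Variables (k : closedFieldType) (A : algType k) (m : nat).
Variables (y : 'I_m -> A) (w : 'I_m -> nat).
Hypothesis w_gt0 : forall i, (0 < w i)%N.

Definition word_weight (s : seq 'I_m) : nat := \sum_(i <- s) w i.
Definition word_prod (s : seq 'I_m) : A := \prod_(i <- s) y i.

Inductive filt (n : nat) : A -> Prop :=
  | filt0 : filt n 0
  | filt_word s : (word_weight s <= n)%N -> filt n (word_prod s)
  | filt_lin c x z : filt n x -> filt n z -> filt n (c *: x + z).

Lemma filt_sub n : subspace (filt n).
Proof. by split; [exact: filt0|exact: filt_lin]. Qed.

Lemma filt_leq n n' x : (n <= n')%N -> filt n x -> filt n' x.
Proof.
move=> h; elim=> {x} [|s hs|c x z _ IHx _ IHz]; [exact: filt0| |exact: filt_lin].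
by apply: filt_word; apply: leq_trans h.
Qed.

Lemma filt_mul n n' x z : filt n x -> filt n' z -> filt (n + n') (x * z).
Proof.
elim=> {x} [|s hs|c x x' _ IHx _ IHx'] hz; first by rewrite mul0r; exact: filt0.
  elim: hz => {z} [|s' hs'|c z z' _ IHz _ IHz']; first by rewrite mulr0; exact: filt0.
    rewrite /word_prod -big_cat; apply: filt_word.
    by rewrite /word_weight big_cat leq_add.
  by rewrite mulrDr -scalerAr; apply: filt_lin.
by rewrite mulrDl -scalerAl; apply: filt_lin; [exact: IHx|exact: IHx'].
Qed.

Lemma filt_gen i : filt (w i) (y i).
Proof.
have -> : y i = word_prod [:: i] by rewrite /word_prod big_seq1.
by apply: filt_word; rewrite /word_weight big_seq1.
Qed.

Lemma filt1 n : filt n 1.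
Proof.
have -> : (1 : A) = word_prod [::] by rewrite /word_prod big_nil.
by apply: filt_word; rewrite /word_weight big_nil.
Qed.

Hypothesis y_comm : forall i j, filt (w i + w j).-1 (comm (y i) (y j)).

Lemma word_move s i s' : filt (word_weight (i :: s ++ s')).-1
  (word_prod (s ++ i :: s') - word_prod (i :: s ++ s')).
Proof.
elim: s => [|j s IH] /=; first by rewrite subrr; exact: filt0.
rewrite /word_prod /word_weight !big_cons -/(word_prod (s ++ i :: s')) -/(word_prod (s ++ s')).
rewrite -/(word_weight (s ++ s')).
have -> : y j * word_prod (s ++ i :: s') - y i * (y j * word_prod (s ++ s')) =
    y j * (word_prod (s ++ i :: s') - word_prod (i :: s ++ s'))
    + comm (y j) (y i) * word_prod (s ++ s').
  by rewrite /comm mulrBl mulrBr /word_prod big_cons !mulrA; lin k A.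
apply: (subspaceD (filt_sub _)).
  apply: filt_leq (filt_mul (filt_gen j) IH).
  by rewrite /word_weight big_cons; have := w_gt0 i; lia.
apply: filt_leq (filt_mul (y_comm j i) (filt_word (leqnn _))).
by have := w_gt0 i; have := w_gt0 j; lia.
Qed.

Lemma word_weight_cons i s : word_weight (i :: s) = (w i + word_weight s)%N.
Proof. by rewrite /word_weight big_cons. Qed.

Lemma word_weight_perm s s' : perm_eq s s' -> word_weight s = word_weight s'.
Proof. by move=> h; apply: perm_big. Qed.

Lemma word_perm s s' : perm_eq s s' ->
  filt (word_weight s).-1 (word_prod s' - word_prod s).
Proof.
elim: s s' => [|i s IH] s' h.
  have /perm_nilP -> : perm_eq s' [::] by rewrite perm_sym.
  by rewrite subrr; exact: filt0.
have is' : i \in s' by rewrite -(perm_mem h) mem_head.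
have [s1 [s2 es']] : exists s1 s2, s' = s1 ++ i :: s2.
  by case/splitPr: is' => s1 s2; exists s1, s2.
subst s'.
have h' : perm_eq s (s1 ++ s2).
  by rewrite -(perm_cons i) (perm_trans h) // perm_catC /= perm_cons perm_catC.
have -> : word_prod (s1 ++ i :: s2) - word_prod (i :: s) =
    (word_prod (s1 ++ i :: s2) - word_prod (i :: s1 ++ s2)) +
    y i * (word_prod (s1 ++ s2) - word_prod s).
  by rewrite mulrBr /word_prod !big_cons; lin k A.
rewrite word_weight_cons (word_weight_perm h').
apply: (subspaceD (filt_sub _)).
  by rewrite -word_weight_cons; exact: word_move.
have [s0|[j [s3 es]]] : s = [::] \/ exists j s3, s = j :: s3.
    by case: (s) => [|j s3]; [left|right; exists j, s3].
  have /perm_nilP -> : perm_eq (s1 ++ s2) [::] by rewrite -s0 perm_sym.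
  by rewrite s0 subrr mulr0; exact: filt0.
apply: filt_leq (filt_mul (filt_gen i) (IH _ h')).
rewrite -(word_weight_perm h') es word_weight_cons.
by have := w_gt0 j; lia.
Qed.

Definition mword (a : 'X_{1..m}) : seq 'I_m := flatten [seq nseq (a i) i | i <- index_enum 'I_m].
Definition mon (a : 'X_{1..m}) : A := word_prod (mword a).
Definition mweight (a : 'X_{1..m}) : nat := \sum_i a i * w i.

Lemma count_mword a i : count_mem i (mword a) = a i.
Proof.
rewrite /mword count_flatten sumnE !big_map (bigD1 i) //= count_nseq /= eqxx mul1n.
by rewrite big1 ?addn0 // => j /negbTE ji; rewrite count_nseq /= ji.
Qed.

Lemma word_weight_mword a : word_weight (mword a) = mweight a.
Proof.
rewrite /word_weight /mword big_flatten big_map; apply: eq_bigr => i _ /=.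
by rewrite big_nseq iter_addn_0 mulnC.
Qed.

Lemma mword_perm (a : 'X_{1..m}) s : (forall i, count_mem i s = a i) -> perm_eq (mword a) s.
Proof. by move=> h; apply/allP => i _ /=; rewrite count_mword h. Qed.

Lemma mweightD (a b : 'X_{1..m}) : mweight (a + b)%MM = (mweight a + mweight b)%N.
Proof. by rewrite /mweight -big_split; apply: eq_bigr => i _; rewrite mnmDE mulnDl. Qed.

Lemma mweightU i : mweight U_(i)%MM = w i.
Proof.
rewrite /mweight (bigD1 i) //= mnm1E eqxx mul1n big1 ?addn0 // => j /negbTE ji.
by rewrite mnm1E eq_sym ji.
Qed.

Lemma mon_mul i a : filt (mweight a + w i).-1 (y i * mon a - mon (a + U_(i))%MM).
Proof.
have h : perm_eq (mword (a + U_(i))%MM) (i :: mword a).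
  by apply: mword_perm => j; rewrite /= count_mword mnmDE mnm1E addnC.
have := word_perm h; rewrite word_weight_mword mweightD mweightU.
by rewrite {1}/word_prod big_cons.
Qed.

Lemma mon0 : mon 0%MM = 1.
Proof.
rewrite /mon; have /perm_nilP -> : perm_eq (mword 0%MM) [::].
  by apply: mword_perm => i; rewrite mnm0E.
by rewrite /word_prod big_nil.
Qed.

Variable theta : A.
Hypothesis theta_comm : forall i, theta * y i = y i * theta.
Variable N : A -> Prop.
Hypotheses (hN : subspace N) (hNm : forall a x, N x -> N (a * x)).

Definition peval (g : {poly k}) : A := (map_poly (in_alg A) g).[theta].

Lemma peval_comm g x : theta * x = x * theta -> peval g * x = x * peval g.
Proof.
move=> h; rewrite /peval; elim/poly_ind: g => [|g c IH].
  by rewrite rmorph0 horner0 mul0r mulr0.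
rewrite rmorphD rmorphM /= map_polyX map_polyC /= hornerD hornerMX hornerC.
rewrite mulrDl mulrDr -scalerAl -scalerAr mul1r mulr1; congr (_ + _).
by rewrite -mulrA h mulrA IH mulrA.
Qed.

Lemma peval_mon g a : peval g * mon a = mon a * peval g.
Proof.
apply: peval_comm; rewrite /mon /word_prod; elim: (mword a) => [|i s IH].
  by rewrite big_nil mul1r mulr1.
by rewrite big_cons mulrA theta_comm -mulrA IH mulrA.
Qed.

Lemma peval_lin c g h : peval (c *: g + h) = c *: peval g + peval h.
Proof. by rewrite /peval rmorphD /= map_polyZ hornerD hornerZ mulr_algl. Qed.

Lemma pevalM g h : peval (g * h) = peval g * peval h.
Proof.
rewrite /peval rmorphM /= hornerM_comm // /comm_poly -/(peval h).
by rewrite peval_comm.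
Qed.

Lemma pevalC c : peval c%:P = c%:A.
Proof. by rewrite /peval map_polyC /= hornerC. Qed.

Lemma pevalXsub c : peval ('X - c%:P) = theta - c%:A.
Proof. by rewrite /peval rmorphB /= map_polyX map_polyC /= hornerXsubC. Qed.

Lemma pevalB g h : peval (g - h) = peval g - peval h.
Proof. by rewrite /peval rmorphB hornerD hornerN. Qed.

Lemma peval1 : peval 1 = 1.
Proof. by rewrite /peval rmorph1 hornerC. Qed.

Lemma peval0 : peval 0 = 0.
Proof. by rewrite /peval rmorph0 horner0. Qed.

Inductive span (Q : 'X_{1..m} -> bool) : A -> Prop :=
  | span_N x : N x -> span Q x
  | span_mon a g : Q a -> span Q (mon a * peval g)
  | span_lin c x z : span Q x -> span Q z -> span Q (c *: x + z).

Lemma span_sub Q : subspace (span Q).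
Proof. by split; [apply: span_N; exact: subspace0|exact: span_lin]. Qed.

Lemma span_incl (Q Q' : pred 'X_{1..m}) x : (forall a, Q a -> Q' a) -> span Q x -> span Q' x.
Proof.
move=> h; elim=> {x} [x Nx|a g /h Qa|c x z _ IHx _ IHz];
  [exact: span_N|exact: span_mon|exact: span_lin].
Qed.

Lemma span_peval Q g x : span Q x -> span Q (peval g * x).
Proof.
elim=> {x} [x Nx|a h Qa|c x z _ IHx _ IHz]; first by apply: span_N; exact: hNm.
  by rewrite mulrA peval_mon -mulrA -pevalM; exact: span_mon.
by rewrite mulrDr -scalerAr; exact: span_lin.
Qed.

(** Straightening: by [word_perm] a word is its ordered monomial up to smaller weight, so induction
    on n applies. *)
Lemma filt_span n x (Q : 'X_{1..m} -> bool) g :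
  (forall a, (mweight a <= n)%N -> Q a) -> filt n x -> span Q (x * peval g).
Proof.
elim/ltn_ind: n x => n IH x hQ.
elim=> {x} [|s hs|c x z _ IHx _ IHz].
- by rewrite mul0r; exact: subspace0 (span_sub Q).
- pose a := [multinom count_mem i s | i < m].
  have pa : perm_eq (mword a) s by apply: mword_perm => i; rewrite mnmE.
  have wa : mweight a = word_weight s.
    by rewrite -word_weight_mword; apply: word_weight_perm.
  rewrite -[word_prod s](subrK (mon a)) mulrDl addrC; apply: (subspaceD (span_sub Q)).
    by apply: span_mon; apply: hQ; rewrite wa.
  case: s => [|i s] in hs a pa wa *.
    by have := perm_size pa; move/eqP; rewrite size_eq0 /mon => /eqP ->; rewrite subrr mul0r; exact: subspace0 (span_sub Q).
  have := word_perm pa; rewrite word_weight_mword wa; apply: IH.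
    by apply: leq_trans hs; rewrite word_weight_cons; have := w_gt0 i; lia.
  by move=> b hb; apply: hQ; apply: leq_trans hb _; apply: leq_trans hs; exact: leq_pred.
- by rewrite mulrDl -scalerAl; apply: span_lin.
Qed.

(** The weight is compared first, so that all corrections produced by reordering a word count as
    lower terms. *)
Definition mlt (a b : 'X_{1..m}) : bool :=
  (mweight a < mweight b)%N || ((mweight a == mweight b) && (a < b)%O).

Definition mle (a b : 'X_{1..m}) : bool := (a == b) || mlt a b.

Lemma mlt_total a b : a != b -> mlt a b || mlt b a.
Proof.
by move=> ab; rewrite /mlt; case: ltngtP => //= _; move: ab; case: ltgtP.
Qed.

Lemma mlt_trans a b c : mlt a b -> mlt b c -> mlt a c.
Proof.
rewrite /mlt => /orP[ab|/andP[/eqP -> ab]] /orP[bc|/andP[/eqP e bc]].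
- by rewrite (ltn_trans ab bc).
- by rewrite -e ab.
- by rewrite bc.
- by rewrite e eqxx (lt_trans ab bc) orbT.
Qed.

Lemma mlt_addU a b i : mlt a b -> mlt (a + U_(i))%MM (b + U_(i))%MM.
Proof. by rewrite /mlt !mweightD ltn_add2r eqn_add2r ltmc_add2l. Qed.

Lemma mlt_wf : well_founded (fun a b => mlt a b).
Proof.
move=> a; have [n ha] : exists n, mweight a = n by exists (mweight a).
elim/ltn_ind: n a ha => n IHn a; elim/(@ltmwf m): a => a IHa ha; constructor => b.
case/orP => [lt|/andP[/eqP e lt]]; last by apply: IHa; rewrite // e.
by apply: IHn (erefl (mweight b)); rewrite -ha.
Qed.

Local Notation below a := (span (fun b => mlt b a)).
Local Notation upto a := (span (fun b => mle b a)).

Lemma below_mul i a x : below a x -> below (a + U_(i))%MM (y i * x).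
Proof.
elim=> {x} [x Nx|b g ba|c x z _ IHx _ IHz]; first by apply: span_N; apply: hNm.
  rewrite mulrA -[y i * mon b](subrK (mon (b + U_(i))%MM)) mulrDl.
  apply: (subspaceD (span_sub _)); last by apply: span_mon; exact: mlt_addU.
  apply: filt_span (mon_mul i b) => c hc; apply/orP; left.
  rewrite mweightD mweightU; have := w_gt0 i.
  have : (mweight b <= mweight a)%N by case/orP: ba => [/ltnW//|/andP[/eqP -> //]].
  lia.
by rewrite mulrDr -scalerAr; exact: span_lin.
Qed.

(** For fixed a these g form an ideal of k[X], and the graded piece of A / N at the monomial a is
    the quotient of k[X] by it. *)
Definition lead (a : 'X_{1..m}) (g : {poly k}) : Prop := below a (mon a * peval g).

Lemma lead_mulU a i g : lead a g -> lead (a + U_(i))%MM g.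
Proof.
move=> h; rewrite /lead -[mon _ * _](subKr (y i * (mon a * peval g))).
apply: (subspaceB (span_sub _)); first exact: below_mul.
rewrite mulrA -mulrBl; apply: filt_span (mon_mul i a) => c hc; apply/orP; left.
by rewrite mweightD mweightU; have := w_gt0 i; lia.
Qed.

(** The ideals grow along divisibility of monomials, so that Dickson's lemma reduces the nonzero
    ones to finitely many. *)
Lemma lead_le a b g : (a <= b)%MM -> lead a g -> lead b g.
Proof.
move=> ab la; have [n hn] : exists n, mdeg (b - a)%MM = n by exists (mdeg (b - a)%MM).
elim: n b ab hn => [|n IH] b ab hn.
  move/eqP: hn; rewrite mdeg_eq0 => /eqP e.
  by rewrite -(submK ab) e add0m.
have [i hi] : exists i, (a i < b i)%N.
  apply: NNPP => nh; move: hn; rewrite mdegE big1 // => i _; rewrite mnmBE.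
  by apply/eqP; rewrite subn_eq0 leqNgt; apply/negP => lt; apply: nh; exists i.
have Ub : (U_(i) <= b)%MM by rewrite lep1mP -lt0n (leq_ltn_trans _ hi).
rewrite -(submK Ub); apply: lead_mulU; apply: IH.
  apply/mnm_lepP => j; rewrite mnmBE mnm1E.
  case: eqP => [<-|_]; first by move: hi; lia.
  by rewrite subn0; exact/mnm_lepP.
move: hn; rewrite -{1}(submK Ub) !mdegE => hn; apply: succn_inj; rewrite -hn.
rewrite (bigD1 i) //= [in RHS](bigD1 i) //= -addSn; congr (_ + _)%N.
  by rewrite !(mnmBE, mnmDE, mnm1E) eqxx; move: hi; lia.
by apply: eq_bigr => j /negbTE ji; rewrite !(mnmBE, mnmDE, mnm1E) eq_sym ji; lia.
Qed.

Lemma lead_mulp a g h : lead a g -> lead a (h * g).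
Proof.
by move=> lg; rewrite /lead pevalM mulrA -peval_mon -mulrA; exact: span_peval.
Qed.

Lemma leadD a g h : lead a g -> lead a h -> lead a (g + h).
Proof.
move=> hg hh; rewrite /lead -[g]scale1r peval_lin scale1r mulrDr.
exact: (subspaceD (span_sub _)).
Qed.

Lemma upto_decomp a x : upto a x -> exists g z, below a z /\ x = mon a * peval g + z.
Proof.
elim=> {x} [x Nx|b g ba|c x z _ [g [u [hu ->]]] _ [h [v [hv ->]]]].
- by exists 0, x; rewrite peval0 mulr0 add0r; split=> //; apply: span_N.
- have [->|ba'] := eqVneq b a.
    by exists g, 0; rewrite addr0; split=> //; exact: subspace0 (span_sub _).
  exists 0, (mon b * peval g); rewrite peval0 mulr0 add0r; split=> //.
  by apply: span_mon; move: ba; rewrite /mle (negbTE ba').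
- exists (c *: g + h), (c *: u + v); split; first exact: span_lin.
  by rewrite peval_lin mulrDr -scalerAr; lin k A.
Qed.

Lemma upto_leq b b' x : mlt b b' -> upto b x -> upto b' x.
Proof.
move=> bb'; apply: span_incl => s; rewrite /mle => /orP[/eqP ->|sb].
  by rewrite bb' orbT.
by rewrite (mlt_trans sb bb') orbT.
Qed.

Lemma span_upto Q x : span Q x -> N x \/ exists2 b, Q b & upto b x.
Proof.
elim=> {x} [x Nx|b g Qb|c x z _ IHx _ IHz]; first by left.
  by right; exists b => //; apply: span_mon; rewrite /mle eqxx.
case: IHx IHz => [Nx|[b Qb hx]] [Nz|[b' Qb' hz]].
- by left; apply: hN.2.
- by right; exists b' => //; apply: span_lin => //; apply: span_N.
- by right; exists b => //; apply: span_lin => //; apply: span_N.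
- right; have [e|bb'] := eqVneq b b'; first by subst b'; exists b => //; apply: span_lin.
  case/orP: (mlt_total bb') => lt; [exists b'|exists b] => //; apply: span_lin => //.
    exact: upto_leq hx.
  exact: upto_leq hz.
Qed.

Lemma mlt0 a : a != 0%MM -> mlt 0%MM a.
Proof.
move=> a0; have [i hi] : exists i, (0 < a i)%N.
  apply: NNPP => nh; case/eqP: a0; apply/mnmP => i; rewrite mnm0E.
  by apply/eqP; rewrite eqn0Ngt; apply/negP => lt; apply: nh; exists i.
apply/orP; left; rewrite /mweight [X in (X < _)%N]big1 => [|j _]; last by rewrite mnm0E.
by rewrite (bigD1 i) //= addn_gt0 muln_gt0 hi w_gt0.
Qed.

Lemma below0 x : below 0%MM x -> N x.
Proof.
elim=> {x} // [b g|c x z _ Nx _ Nz]; last exact: hN.2.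
have [->|/mlt0 h /(mlt_trans h)] := eqVneq b 0%MM; by rewrite /mlt ltnn ltxx andbF.
Qed.

(* If theta - c were surjective for every c while no nonzero polynomial in
   theta vanishes, the module would be free over the localization k[theta]_F
   for some F != 0, on which theta - c is not surjective as soon as c is not
   a root of F. *)
Theorem generic_freeness :
  (forall g, N (peval g) -> g = 0) ->
  (forall c, exists2 u, span predT u & N (1 - (theta - c%:A) * u)) -> False.
Proof.
move=> inj surj.
have [G hG Gd] := dickson (fun a => exists2 g, g != 0 & lead a g).
(* F is a product of one nonzero element for each of the finitely many exponents in G; it then lies
   in every nonzero leading ideal. *)
have [F F0 hF] : exists2 F : {poly k}, F != 0 & {in G, forall a, lead a F}.
  elim: G hG {Gd} => [|a G IH] hG; first by exists 1; rewrite ?oner_neq0.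
  have [F F0 hF] := IH (fun b hb => hG b (mem_behead (s := a :: G) hb)).
  have [g g0 hg] := hG a (mem_head _ _).
  exists (F * g); first by rewrite mulf_neq0.
  by move=> b; rewrite inE => /orP[/eqP ->|/hF h]; [|rewrite mulrC]; exact: lead_mulp.
have {Gd hG}leadF a g : g != 0 -> lead a g -> lead a F.
  by move=> g0 lg; have [b bG ba] := Gd a (ex_intro2 _ _ g g0 lg); apply: lead_le ba (hF _ bG).
have [c Fc] : exists c, ~~ root F c by exact/closed_nonrootP.
have [u hu Nu] := surj c.
(* Each graded piece is free over k[theta] or killed by F. As F(c) is nonzero, theta - c is
   injective on it in both cases. *)
have key a z : upto a z -> below a (peval ('X - c%:P) * z) -> below a z.
  move=> /upto_decomp[g [z' [hz' ->]]].
  rewrite mulrDr mulrA peval_mon -mulrA -pevalM => hb.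
  have lg : lead a (('X - c%:P) * g).
    rewrite /lead -[_ * _](addrK (peval ('X - c%:P) * z')).
    by apply: (subspaceB (span_sub _)) => //; exact: span_peval.
  apply: (subspaceD (span_sub _)) => //.
  have [->|g0] := eqVneq g 0.
    by rewrite peval0 mulr0; exact: subspace0 (span_sub _).
  have lF : lead a F.
    by apply: leadF lg; rewrite mulf_neq0 // polyXsubC_eq0.
  have /factor_theorem[q hq] : root (F - F.[c]%:P) c.
    by rewrite rootE hornerD hornerN hornerC subrr.
  have -> : g = (F.[c]^-1%:P * g) * F + (- F.[c]^-1%:P * q) * (('X - c%:P) * g).
    have : F.[c]^-1%:P * F.[c]%:P = 1 :> {poly k} by rewrite -polyCM mulVf.
    have -> : F.[c]%:P = F - q * ('X - c%:P) by rewrite -hq subKr.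
    by move=> e; rewrite -{1}[g]mul1r -e; ring.
  by apply: leadD; apply: lead_mulp.
have N1 : ~ N 1.
  rewrite -peval1 => /inj/eqP.
  by rewrite oner_eq0.
have [a ha] : exists a, upto a u.
  case: (span_upto hu) => [Nu'|[a _ ha]]; last by exists a.
  by exists 0%MM; apply: span_N.
(* Since 1 is lower than any monomial of nonzero exponent, [key] lowers the leading exponent of u
   until it is 0. Then u is g(theta) modulo N, and N contains the value at theta of 1 - (X - c) g, a
   polynomial with value 1 at c. *)
elim/(well_founded_ind mlt_wf): a ha => a IH ha.
have [a0|a0] := eqVneq a 0%MM.
  subst a; have [g [z [/below0 Nz eu]]] := upto_decomp ha.
  have : N (peval (1 - ('X - c%:P) * g)).
    have -> : peval (1 - ('X - c%:P) * g) = 1 - (theta - c%:A) * u + (theta - c%:A) * z.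
      by rewrite eu mon0 mul1r pevalB peval1 pevalM pevalXsub mulrDr; lin k A.
    by apply: (subspaceD hN) => //; exact: hNm.
  move/inj/(congr1 (horner^~ c)); rewrite !hornerE subrr mul0r subr0 => /eqP.
  by rewrite oner_eq0.
have h1 : below a 1.
  by rewrite -[1]mulr1 -{1}mon0 -peval1; apply: span_mon; exact: mlt0.
have hu' : below a u.
  apply: key ha _; rewrite pevalXsub -[_ * u](subKr 1).
  by apply: (subspaceB (span_sub _)) => //; apply: span_N.
have [Nu'|[b ba hb]] := span_upto hu'; last exact: IH hb.
by apply: N1; rewrite -[1](subrK ((theta - c%:A) * u)); apply: (subspaceD hN) => //; exact: hNm.
Qed.

End Freeness.

(** * The canonical filtration of the W-algebra *)

Section Filtration.
Variables (k : closedFieldType) (A : algType k) (p1 p2 s12 s21 : nat).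
Hypothesis hchar : [pchar k] =i pred0.
Variables (d1 d2 e f : nat -> A).
Hypothesis hs : (p1 + s12 + s21 = p2)%N.
Hypothesis hW : W_relations p1 s12 s21 d1 d2 e f.
Hypothesis hgen : forall x, gen_subalg (fun y => (exists2 r, (0 < r)%N & y = d1 r)
                                  \/ (exists2 r, (0 < r)%N & y = d2 r)
                                  \/ (exists2 r, (s12 < r)%N & y = e r)
                                  \/ (exists2 r, (s21 < r)%N & y = f r)) x.

Local Notation d := (d0 d1).
Local Notation D := (d0 d2).

Inductive W_gen : A -> nat -> Prop :=
  | W_gen_d1 r : (0 < r)%N -> W_gen (d1 r) r
  | W_gen_d2 r : (0 < r)%N -> W_gen (d2 r) r
  | W_gen_e r : (s12 < r)%N -> W_gen (e r) r
  | W_gen_f r : (s21 < r)%N -> W_gen (f r) r.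

(** A finite list: [e_rec] and [f_rec] reduce the e's and f's to the first p1 of each, and [filt_D]
    reduces the d2's to the first p2. The weight of a generator is its superscript. *)
Definition W_gens : seq (A * nat) :=
  [seq (d1 r, r) | r <- iota 1 p1] ++ [seq (d2 r, r) | r <- iota 1 p2] ++
  [seq (e r, r) | r <- iota s12.+1 p1] ++ [seq (f r, r) | r <- iota s21.+1 p1].

Definition W_y (i : 'I_(size W_gens)) : A := (nth (0, 0%N) W_gens i).1.
Definition W_w (i : 'I_(size W_gens)) : nat := (nth (0, 0%N) W_gens i).2.

Lemma W_gensP x n : (x, n) \in W_gens -> W_gen x n.
Proof.
clear hs; rewrite !mem_cat => /or4P[] /mapP[r]; rewrite mem_iota => hr [-> ->].
- by apply: W_gen_d1; lia.
- by apply: W_gen_d2; lia.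
- by apply: W_gen_e; lia.
- by apply: W_gen_f; lia.
Qed.

Lemma W_yP i : W_gen (W_y i) (W_w i).
Proof. by apply: W_gensP; rewrite /W_y /W_w -surjective_pairing mem_nth. Qed.

Lemma W_w_gt0 i : (0 < W_w i)%N.
Proof. by case: (W_yP i) => r //; apply: leq_trans. Qed.

Local Notation filt := (filt W_y W_w).
Let sub n : subspace (filt n) := filt_sub _ _ n.

Lemma filt_W_gens x n : (x, n) \in W_gens -> filt n x.
Proof.
move=> h; have hi : (index (x, n) W_gens < size W_gens)%N by rewrite index_mem.
have := filt_gen W_y W_w (Ordinal hi).
by rewrite /W_y /W_w /= nth_index.
Qed.

Lemma filt_d r : filt r (d r).
Proof.
case: r => [|r]; first exact: filt1.
have [rp|pr] := leqP r.+1 p1; last by rewrite (W_d1_trunc hW pr); exact: filt0.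
apply: filt_W_gens; rewrite mem_cat; apply/orP; left.
by apply/mapP; exists r.+1 => //; rewrite mem_iota; lia.
Qed.

Lemma e_rec s : (s12 < s)%N -> \sum_(t < p1.+1) d t * e (p1 + s - t)%N = 0.
Proof.
move=> h; have := W_d_e hW p1.+1 h.
by rewrite (W_d1_trunc hW) // /comm mul0r mulr0 subrr => /esym.
Qed.

Lemma f_rec s : (s21 < s)%N -> \sum_(t < p1.+1) f (p1 + s - t)%N * d t = 0.
Proof.
move=> h; have := W_d_f hW p1.+1 h.
rewrite (W_d1_trunc hW) // /comm mul0r mulr0 subrr => /esym/eqP.
by rewrite oppr_eq0 => /eqP.
Qed.

Lemma filt_e r : (s12 < r)%N -> filt r (e r).
Proof.
elim/ltn_ind: r => r IH hr; have [rp|pr] := leqP r (s12 + p1).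
  apply: filt_W_gens; rewrite !mem_cat; apply/or4P; constructor 3.
  by apply/mapP; exists r => //; rewrite mem_iota; lia.
have hr' : (s12 < r - p1)%N by lia.
have /eqP := e_rec hr'; rewrite subnKC; last by lia.
rewrite big_ord_recl /= mul1r subn0 addr_eq0 => /eqP ->.
apply: (subspaceN (sub r)); apply: (subspace_sum (sub r)) => i _.
have hi := ltn_ord i; rewrite -[X in filt X _](@subnKC (bump 0 i) r); last by rewrite /bump; lia.
apply: filt_mul; first exact: filt_d.
by apply: IH; rewrite /bump; lia.
Qed.

Lemma filt_f r : (s21 < r)%N -> filt r (f r).
Proof.
elim/ltn_ind: r => r IH hr; have [rp|pr] := leqP r (s21 + p1).
  apply: filt_W_gens; rewrite !mem_cat; apply/or4P; constructor 4.
  by apply/mapP; exists r => //; rewrite mem_iota; lia.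
have hr' : (s21 < r - p1)%N by lia.
have /eqP := f_rec hr'; rewrite subnKC; last by lia.
rewrite big_ord_recl /= mulr1 subn0 addr_eq0 => /eqP ->.
apply: (subspaceN (sub r)); apply: (subspace_sum (sub r)) => i _.
have hi := ltn_ord i; rewrite -[X in filt X _](@subnK (bump 0 i) r); last by rewrite /bump; lia.
apply: filt_mul; last exact: filt_d.
by apply: IH; rewrite /bump; lia.
Qed.

(** The coefficient of u^-n in d1(u)^-1 d2(u), the series that appears in [e, f]. *)
Definition h_coef (n : nat) : A := \sum_(t < n.+1) dtil d1 t * D (n - t)%N.

Lemma h_conv n : \sum_(t < n.+1) d t * h_coef (n - t) = D n.
Proof.
pose P := \poly_(i < n.+1) d i; pose T := \poly_(i < n.+1) dtil d1 i.
pose Q := \poly_(i < n.+1) D i.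
have hTQ j : (j <= n)%N -> (T * Q)`_j = h_coef j.
  move=> jn; rewrite coefM; apply: eq_bigr => i _.
  by rewrite !coef_poly !ltnS (leq_trans _ jn) ?(leq_trans (leq_subr _ _) jn) // -ltnS.
have hPT j : (j <= n)%N -> (P * T)`_j = (j == 0%N)%:R.
  move=> jn; rewrite coefM -(dtil_conv d1); apply: eq_bigr => i _.
  by rewrite !coef_poly !ltnS (leq_trans _ jn) ?(leq_trans (leq_subr _ _) jn) // -ltnS.
transitivity ((P * T * Q)`_n).
  rewrite -mulrA coefM; apply: eq_bigr => i _.
  by rewrite hTQ ?leq_subr // coef_poly ltn_ord.
rewrite coefM big_ord_recl /= hPT // mul1r subn0 coef_poly ltnSn big1 ?addr0 // => i _.
by rewrite hPT /bump ?mul0r.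
Qed.

Lemma h_coef_comm r s : (s12 < r)%N -> (s21 < s)%N -> h_coef (r + s).-1 = - comm (e r) (f s).
Proof.
move=> hr hs'; case: hW => _ [h _]; rewrite h // opprK /h_coef prednK //.
by rewrite addn_gt0 (leq_ltn_trans _ hr).
Qed.

(** For n > p2, [D n] is the sum of the [d t * h_coef (n - t)], and each such [h_coef] is minus a
    commutator of an e with a fixed [f s]. Commuting the recursion [e_rec] with [f s] transfers
    these commutators from the e's to the d's, leaving products of generators of total weight n. The
    inequality n > p2 is what makes s exceed s21. *)
Lemma filt_D n : filt n (D n).
Proof.
have [np|pn] := leqP n p2.
  case: n np => [|n] np; first exact: filt1.
  apply: filt_W_gens; rewrite !mem_cat; apply/or4P; constructor 2.
  by apply/mapP; exists n.+1 => //; rewrite mem_iota; lia.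
pose s := (n - p1 - s12)%N; have hss : (s21 < s)%N by rewrite /s; lia.
have en : n = (p1 + (s12.+1 + s).-1)%N by rewrite /s; lia.
have -> : D n = \sum_(t < p1.+1) comm (d t) (f s) * e (p1 + s12.+1 - t)%N.
  rewrite -h_conv (big_ord_widen_cond n.+1 xpredT (fun t => comm (d t) (f s) * e (p1 + s12.+1 - t)%N)); last by lia.
  rewrite [RHS]big_mkcond /=.
  pose z t := if (t < p1.+1)%N then d t * e (p1 + s12.+1 - t)%N else 0.
  have z0 : \sum_(t < n.+1) z t = 0.
    rewrite /z -big_mkcond -(big_ord_widen n.+1 (fun t => d t * e (p1 + s12.+1 - t)%N)); last by lia.
    exact: e_rec.
  apply/eqP; rewrite -subr_eq0; apply/eqP.
  transitivity (f s * \sum_(t < n.+1) z t - (\sum_(t < n.+1) z t) * f s); last first.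
    by rewrite z0 mulr0 mul0r subrr.
  rewrite mulr_sumr mulr_suml -!sumrB; apply: eq_bigr => t _; rewrite /z.
  case: ltnP => tp; last by rewrite (W_d1_trunc hW) // !mul0r mulr0 !subr0.
  have -> : (n - t = ((p1 + s12.+1 - t) + s).-1)%N by rewrite /s; lia.
  rewrite h_coef_comm //; last by lia.
  by rewrite /comm mulrN mulrBr mulrBl !mulrA; lin k A.
apply: (subspace_sum (sub n)) => t _; have tp := ltn_ord t.
have -> : n = ((t + s).-1 + (p1 + s12.+1 - t))%N by rewrite /s; lia.
apply: filt_mul; last by apply: filt_e; lia.
rewrite (W_d_f hW) //; apply: (subspaceN (sub _)); apply: (subspace_sum (sub _)) => u _.
have ut := ltn_ord u; rewrite -[X in filt X _](@subnK u (t + s).-1); last by lia.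
by apply: filt_mul; [apply: filt_f; lia|exact: filt_d].
Qed.

Lemma commC (x z : A) : comm x z = - comm z x.
Proof. by rewrite /comm opprB. Qed.

(** The hypothesis moves superscripts from one factor to the other at the cost of lower terms.
    Moving the difference of the two superscripts across compares a commutator with its opposite, so
    twice the commutator is of lower weight. *)
Lemma filt_exchange (g : nat -> A) c :
  (forall r s, (c < r)%N -> (c < s)%N ->
    filt (r + s) (comm (g r) (g s.+1) - comm (g r.+1) (g s))) ->
  forall r s, (c < r)%N -> (c < s)%N -> filt (r + s).-1 (comm (g r) (g s)).
Proof.
move=> hg.
have step j : forall r s, (c < r)%N -> (c < s)%N ->
    filt (r + s + j).-1 (comm (g r) (g (s + j)%N) - comm (g (r + j)%N) (g s)).
  elim: j => [|j IH] r s hr hs'; first by rewrite !addn0 subrr; exact: filt0.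
  have -> : comm (g r) (g (s + j.+1)%N) - comm (g (r + j.+1)%N) (g s) =
      (comm (g r) (g (s + j).+1) - comm (g r.+1) (g (s + j)%N)) +
      (comm (g r.+1) (g (s + j)%N) - comm (g (r.+1 + j)%N) (g s)).
    by rewrite addnS (addnS r) addSn; lin k A.
  apply: (subspaceD (sub _)).
    apply: filt_leq (hg r (s + j)%N hr _); last by lia.
    by lia.
  apply: filt_leq (IH r.+1 s _ hs'); last by lia.
  by lia.
have main r j : (c < r)%N -> filt (r + (r + j)).-1 (comm (g r) (g (r + j)%N)).
  move=> hr; have := step j r r hr hr; rewrite [comm (g (r + j)%N) _]commC opprK.
  rewrite -mulr2n -scaler_nat addnA => h.
  have two : 2%:R != 0 :> k by rewrite char0_natr_eq0.
  by rewrite -[comm _ _](scalerK two); apply: (subspaceZ (sub _)).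
move=> r s hr hs'; have [rs|sr] := leqP r s; first by rewrite -(subnKC rs); exact: main.
rewrite commC addnC -(subnKC (ltnW sr)); apply: (subspaceN (sub _)); exact: main.
Qed.

Lemma filt_comm_e r s : (s12 < r)%N -> (s12 < s)%N -> filt (r + s).-1 (comm (e r) (e s)).
Proof.
apply: filt_exchange => {}r {}s hr hs'.
case: hW => _ [_ [_ [_ [h _]]]]; rewrite h //; apply: (subspaceD (sub _)).
  by apply: filt_mul; exact: filt_e.
by rewrite addnC; apply: filt_mul; exact: filt_e.
Qed.

Lemma filt_comm_f r s : (s21 < r)%N -> (s21 < s)%N -> filt (r + s).-1 (comm (f r) (f s)).
Proof.
apply: filt_exchange => {}r {}s hr hs'.
case: hW => _ [_ [_ [_ [_ [h _]]]]]; rewrite -opprB h //.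
apply: (subspaceN (sub _)); apply: (subspaceD (sub _)).
  by apply: filt_mul; exact: filt_f.
by rewrite addnC; apply: filt_mul; exact: filt_f.
Qed.

Lemma filt_dtil n : filt n (dtil d1 n).
Proof.
elim/ltn_ind: n => -[|n] IH; first exact: filt1.
rewrite dtilS; apply: (subspaceN (sub _)); apply: (subspace_sum (sub _)) => i _.
have hi := ltn_ord i; have hn : (i.+1 + (n - i) <= n.+1)%N by lia.
by apply: filt_leq hn _; apply: filt_mul; [exact: (filt_d i.+1)|apply: IH; lia].
Qed.

Lemma filt_comm_ef r s : (s12 < r)%N -> (s21 < s)%N -> filt (r + s).-1 (comm (e r) (f s)).
Proof.
move=> hr hs'; rewrite -[comm _ _]opprK -h_coef_comm //.
apply: (subspaceN (sub _)); apply: (subspace_sum (sub _)) => t _.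
have ht := ltn_ord t; rewrite -[X in filt X _](@subnKC t (r + s).-1); last by lia.
by apply: filt_mul; [exact: filt_dtil|exact: filt_D].
Qed.

Lemma filt_comm_cartan (g : nat -> A) s c DD : (forall r, (c < r)%N -> filt r (g r)) ->
  (forall r, filt r (DD r)) -> (c < s)%N -> forall r (F : 'I_r -> A),
  (forall t, F t = DD t * g ((r + s).-1 - t)%N \/ F t = g ((r + s).-1 - t)%N * DD t) ->
  filt (r + s).-1 (\sum_t F t).
Proof.
move=> hg hD hc r F hF; apply: (subspace_sum (sub _)) => t _; have ht := ltn_ord t.
case: (hF t) => ->.
  rewrite -[X in filt X _](@subnKC t (r + s).-1); last by lia.
  by apply: filt_mul; [exact: hD|apply: hg; lia].
rewrite -[X in filt X _](@subnK t (r + s).-1); last by lia.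
by apply: filt_mul; [apply: hg; lia|exact: hD].
Qed.

Lemma filt_comm x n x' n' : W_gen x n -> W_gen x' n' -> filt (n + n').-1 (comm x x').
Proof.
have swap u v a b : filt (a + b).-1 (comm u v) -> filt (b + a).-1 (comm v u).
  by move=> h; rewrite addnC commC; apply: (subspaceN (sub _)).
have z u v a : u * v = v * u -> filt a (comm u v).
  by move=> h; rewrite /comm h subrr; exact: filt0.
have eD1 r : (0 < r)%N -> d1 r = d r by case: r.
have eD2 r : (0 < r)%N -> d2 r = D r by case: r.
have de r s : (s12 < s)%N -> filt (r + s).-1 (comm (d r) (e s)).
  move=> hs'; rewrite (W_d_e hW) //; apply: (filt_comm_cartan filt_e filt_d hs') => t; by left.
have De r s : (s12 < s)%N -> filt (r + s).-1 (comm (D r) (e s)).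
  move=> hs'; rewrite (W_D_e hW) //; apply: (subspaceN (sub _)).
  by apply: (filt_comm_cartan filt_e filt_D hs') => t; left.
have df r s : (s21 < s)%N -> filt (r + s).-1 (comm (d r) (f s)).
  move=> hs'; rewrite (W_d_f hW) //; apply: (subspaceN (sub _)).
  by apply: (filt_comm_cartan filt_f filt_d hs') => t; right.
have Df r s : (s21 < s)%N -> filt (r + s).-1 (comm (D r) (f s)).
  move=> hs'; rewrite (W_D_f hW) //.
  by apply: (filt_comm_cartan filt_f filt_D hs') => t; right.
case=> r hr [] s hs'; rewrite ?(eD1 r hr) ?(eD2 r hr) ?(eD1 s hs') ?(eD2 s hs').
- exact/z/(W_dd hW).
- exact/z/(W_dD hW).
- exact: de.
- exact: df.
- by apply/z/esym/(W_dD hW).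
- exact/z/(W_DD hW).
- exact: De.
- exact: Df.
- exact/swap/de.
- exact/swap/De.
- exact: filt_comm_e.
- exact: filt_comm_ef.
- exact/swap/df.
- exact/swap/Df.
- exact/swap/filt_comm_ef.
- exact: filt_comm_f.
Qed.

Lemma filt_all x : exists n, filt n x.
Proof.
move: (hgen x) => /(_ (fun x => exists n, filt n x)); apply.
  split=> [||u v [n hu] [n' hv]|u v [n hu] [n' hv]|c u [n hu]].
  - by exists 0%N; exact: filt0.
  - by exists 0%N; exact: filt1.
  - exists (maxn n n'); apply: (subspaceD (sub _)).
      by apply: filt_leq hu; rewrite leq_maxl.
    by apply: filt_leq hv; rewrite leq_maxr.
  - by exists (n + n')%N; apply: filt_mul.
  - by exists n; apply: (subspaceZ (sub _)).
move=> {x} x [[r r0 ->]|[[r r0 ->]|[[r hr ->]|[r hr ->]]]]; exists r.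
- by have := filt_d r; rewrite /d0; case: r r0.
- by have := filt_D r; rewrite /d0; case: r r0.
- exact: filt_e.
- exact: filt_f.
Qed.

End Filtration.

Section Modules.
Variables (k : closedFieldType) (A : algType k).

Lemma peval_prod_neq0 (theta : A) (P : A -> Prop) :
  ~ P 0 -> (forall c x, P x -> P ((theta - c%:A) * x)) -> (forall c x, c != 0 -> P x -> P (c *: x)) ->
  P 1 -> forall g, g != 0 -> P (peval theta g).
Proof.
move=> P0 PX PZ P1 g g0; have [rs ->] := closed_field_poly_normal g.
rewrite -mul_polyC pevalM pevalC mulr_algl; apply: PZ; first by rewrite lead_coef_eq0.
elim: rs => [|c rs IH]; first by rewrite big_nil peval1.
by rewrite big_cons pevalM pevalXsub; apply: PX.
Qed.

End Modules.

(** * Irreducible modules *)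

Section Irreducible.
Variables (k : closedFieldType) (A : algType k).

Definition ann (V : lmodType A) (v : V) (x : A) : Prop := x *: v = 0.

Lemma ann_sub (V : lmodType A) (v : V) : subspace (ann v).
Proof.
rewrite /ann; split=> [|c x z hx hz]; first by rewrite scale0r.
by rewrite scalerDl hz addr0 -mulr_algl -scalerA hx scaler0.
Qed.

Lemma ann_mul (V : lmodType A) (v : V) a x : ann v x -> ann v (a * x).
Proof. by rewrite /ann -scalerA => ->; rewrite scaler0. Qed.

Lemma irreducible_cyclic (V : lmodType A) (v : V) :
  irreducible_module V -> v != 0 -> forall u, exists a, u = a *: v.
Proof.
case=> _ irr v0; have [] // := irr (fun u => exists a, u = a *: v).
  split=> [|u u' [a ->] [a' ->]|b u [a ->]].
  - by exists 0; rewrite scale0r.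
  - by exists (a + a'); rewrite scalerDl.
  - by exists (b * a); rewrite scalerA.
by move=> h; case/eqP: v0; apply: h; exists 1; rewrite scale1r.
Qed.

Lemma left_ideal_image (V : lmodType A) (v : V) (J : A -> Prop) :
  irreducible_module V -> J 0 -> (forall x z, J x -> J z -> J (x + z)) ->
  (forall a x, J x -> J (a * x)) -> (exists2 x, J x & x *: v != 0) ->
  forall u, exists2 x, J x & u = x *: v.
Proof.
move=> [_ irr] J0 JD JM [x Jx xv] u; have [|h|h] := irr (fun u => exists2 x, J x & u = x *: v).
- split=> [|u1 u2 [x1 J1 ->] [x2 J2 ->]|b u1 [x1 J1 ->]].
  + by exists 0; rewrite ?scale0r.
  + by exists (x1 + x2); rewrite ?scalerDl //; exact: JD.
  + by exists (b * x1); rewrite ?scalerA //; exact: JM.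
- exact: h.
- by case/eqP: xv; apply: h; exists x.
Qed.

(* Otherwise x v_j |-> x v_l, for x annihilating a minimal family of the other
   vectors, would be an isomorphism from V_j onto V_l. *)
Lemma irreducible_density n (V : 'I_n -> lmodType A) (v : forall i, V i) :
  (forall i, irreducible_module (V i)) -> (forall i, v i != 0) ->
  (forall i j, i != j -> ~ isomorphic_modules (V i) (V j)) ->
  forall i, exists x, x *: v i = v i /\ forall j, j != i -> x *: v j = 0.
Proof.
move=> irr v0 niso i.
pose J (B : {set 'I_n}) x := forall j, j \in B -> x *: v j = 0.
have J0 B : J B 0 by move=> j _; rewrite scale0r.
have JD B x z : J B x -> J B z -> J B (x + z).
  by move=> hx hz j jB; rewrite scalerDl hx // hz // addr0.
have JM B a x : J B x -> J B (a * x).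
  by move=> hx j jB; rewrite -scalerA hx // scaler0.
suff H (B : {set 'I_n}) l : l \notin B -> exists2 x, J B x & x *: v l != 0.
  have ex : exists2 x, J (~: [set i]) x & x *: v i != 0.
    by apply: H; rewrite !inE eqxx.
  have [x Jx ex'] := left_ideal_image (irr i) (J0 _) (@JD (~: [set i])) (@JM _) ex (v i).
  by exists x; split=> // j ji; apply: Jx; rewrite !inE.
have [N] := ubnP #|B|; elim: N B l => // N IH B l BN lB.
have [->|[j jB]] := set_0Vmem B.
  by exists 1; [move=> j; rewrite inE|rewrite scale1r v0].
apply: NNPP => nex.
have hB x : J B x -> x *: v l = 0.
  by move=> Jx; apply/eqP; apply: contraT => h; case: nex; exists x.
have cB : (#|B :\ j| < N)%N by move: BN; rewrite (cardsD1 j) jB ltnS.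
have lj : l != j by apply: contraNneq lB => ->.
have [xl Jxl xlv] : exists2 x, J (B :\ j) x & x *: v l != 0.
  by apply: IH; rewrite // !inE (negbTE lB) andbF.
have [xj Jxj xjv] : exists2 x, J (B :\ j) x & x *: v j != 0.
  by apply: IH; rewrite // !inE eqxx.
have surjl := left_ideal_image (irr l) (J0 _) (@JD (B :\ j)) (@JM _) (ex_intro2 _ _ _ Jxl xlv).
have surjj := left_ideal_image (irr j) (J0 _) (@JD (B :\ j)) (@JM _) (ex_intro2 _ _ _ Jxj xjv).
have JB x : J (B :\ j) x -> x *: v j = 0 -> x *: v l = 0.
  move=> Jx xv; apply: hB => j' j'B; have [->//|j'j] := eqVneq j' j.
  by apply: Jx; rewrite !inE j'j.
have rep u : exists x, J (B :\ j) x /\ u = x *: v j.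
  by have [x] := surjj u; exists x.
pose r u := proj1_sig (constructive_indefinite_description _ (rep u)).
have rP u : J (B :\ j) (r u) /\ u = r u *: v j.
  exact: (proj2_sig (constructive_indefinite_description _ (rep u))).
have JBB B' x z : J B' x -> J B' z -> J B' (x - z).
  by move=> hx hz; apply: JD => //; rewrite -mulN1r; apply: JM.
pose phi u := r u *: v l.
have phiE x u : J (B :\ j) x -> u = x *: v j -> phi u = x *: v l.
  move=> Jx eu; have [Jr er] := rP u; apply/eqP; rewrite -subr_eq0 -scalerBl; apply/eqP.
  by apply: JB; [exact: JBB|rewrite scalerBl -eu -er subrr].
have phiD u u' : phi (u + u') = phi u + phi u'.
  have [J1 e1] := rP u; have [J2 e2] := rP u'.
  rewrite (@phiE (r u + r u')) ?scalerDl //; first exact: JD.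
  by rewrite -e1 -e2.
have phiZ a u : phi (a *: u) = a *: phi u.
  have [J1 e1] := rP u.
  by rewrite (@phiE (a * r u)) -?scalerA //; [exact: JM|rewrite -e1].
apply: (niso j l); first by rewrite eq_sym.
have phi0 : phi 0 = 0 by apply: (addIr (phi 0)); rewrite -phiD !add0r.
have inj u : phi u = 0 -> u = 0.
  have [|h|h] := (irr j).2 (fun u => phi u = 0) => //.
    by split=> // [u1 u2 h1 h2|a u1 h1]; rewrite ?phiD ?phiZ ?h1 ?h2 ?addr0 ?scaler0.
  - by case/eqP: xlv; have := h (xl *: v j); rewrite (phiE xl).
  - exact: h.
have surj u' : exists u, phi u = u'.
  by have [x Jx ->] := surjl u'; exists (x *: v j); exact: phiE.
pose psi u' := proj1_sig (constructive_indefinite_description _ (surj u')).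
have psiP u' : phi (psi u') = u'.
  exact: (proj2_sig (constructive_indefinite_description _ (surj u'))).
exists phi; split=> //; exists psi => // u.
apply/eqP; rewrite -subr_eq0; apply/eqP; apply: inj.
by rewrite phiD -scaleN1r phiZ psiP scaleN1r subrr.
Qed.

End Irreducible.

(** * Characters of maximal ideals *)

Section Scalars.
Variables (k : closedFieldType) (A : algType k) (p1 p2 s12 s21 : nat).
Hypothesis hchar : [pchar k] =i pred0.
Variables (d1 d2 e f : nat -> A).
Hypothesis hs : (p1 + s12 + s21 = p2)%N.
Hypothesis hW : W_relations p1 s12 s21 d1 d2 e f.
Hypothesis hgen : forall x, gen_subalg (fun y => (exists2 r, (0 < r)%N & y = d1 r)
                                  \/ (exists2 r, (0 < r)%N & y = d2 r)
                                  \/ (exists2 r, (s12 < r)%N & y = e r)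
                                  \/ (exists2 r, (s21 < r)%N & y = f r)) x.

Lemma peval_not_ann (V : lmodType A) (v : V) theta : v != 0 ->
  (forall c (x : A), x *: v != 0 -> ((theta - c%:A) * x) *: v != 0) ->
  forall g, ann v (peval theta g) -> g = 0.
Proof.
move=> v0 inj g hg; apply/eqP; apply: contraT => g0.
suff : peval theta g *: v != 0 by rewrite hg eqxx.
apply: (@peval_prod_neq0 _ _ theta (fun x => x *: v != 0)) => //.
- by rewrite scale0r eqxx.
- move=> c x c0; apply: contraNneq => h; rewrite -[x](scalerK c0) -mulr_algl.
  by rewrite -scalerA h scaler0.
- by rewrite scale1r.
Qed.

Lemma gen_subalg_subalg (G : A -> Prop) : is_subalg (gen_subalg G).
Proof.
split=> [S [] //|S [] //|a b ha hb S hS hG|a b ha hb S hS hG|c a ha S hS hG];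
  case: (hS) => S0 S1 SD SM SZ; [apply: SD|apply: SM|apply: SZ]; by [apply: ha|apply: hb].
Qed.

(** Quillen's lemma. If no theta - c acted as 0, kernels and images, being submodules, would make
    every theta - c bijective on V; this contradicts generic freeness of the cyclic module V over
    k[theta]. *)
Lemma central_scalar (V : lmodType A) theta : irreducible_module V ->
  centre_W theta -> exists c : k, forall u : V, (theta - c%:A) *: u = 0.
Proof.
move=> irrV ct; apply: NNPP => nex; have [[v v0] irr] := irrV.
have cc c a : a * (theta - c%:A) = (theta - c%:A) * a.
  by rewrite mulrBr mulrBl ct -scalerAl -scalerAr mul1r mulr1.
have inj c (u : V) : (theta - c%:A) *: u = 0 -> u = 0.
  have [|h|h] := irr (fun u : V => (theta - c%:A) *: u = 0).
  - split=> [|x z hx hz|a x hx]; rewrite ?scaler0 ?scalerDr ?hx ?hz ?addr0 //.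
    by rewrite scalerA -cc -scalerA hx scaler0.
  - by case: nex; exists c.
  - exact: h.
have surj c (u : V) : exists u', u = (theta - c%:A) *: u'.
  have [|h|h] := irr (fun u : V => exists u', u = (theta - c%:A) *: u').
  - split=> [|x z [x' ->] [z' ->]|a x [x' ->]].
    + by exists 0; rewrite scaler0.
    + by exists (x' + z'); rewrite scalerDr.
    + by exists (a *: x'); rewrite !scalerA cc.
  - exact: h.
  - by case: nex; exists c => x; apply: h; exists x.
have yc (i j : 'I_(size (W_gens p1 p2 s12 s21 d1 d2 e f))) :=
  filt_comm hchar hs hW (W_yP i) (W_yP j).
have tc (i : 'I_(size (W_gens p1 p2 s12 s21 d1 d2 e f))) : theta * W_y i = W_y i * theta.
  exact: ct.
apply: (generic_freeness (@W_w_gt0 _ _ p1 p2 s12 s21 d1 d2 e f) yc tc (ann_sub v) (@ann_mul _ _ _ v)).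
- apply: peval_not_ann => // c x xv; apply: contraNneq xv; rewrite -scalerA.
  by move/inj => ->.
- move=> c; have [u' hu'] := surj c v; have [x ex] := irreducible_cyclic irrV v0 u'.
  exists x; last by rewrite /ann scalerBl scale1r -scalerA -ex -hu' subrr.
  have [n hn] := filt_all hs hW hgen x; rewrite -[x]mulr1 -(peval1 theta).
  exact: (filt_span (@W_w_gt0 _ _ p1 p2 s12 s21 d1 d2 e f) yc theta (ann_sub v) (Q := predT) 1 (fun _ _ => isT) hn).
Qed.

Variable m : A -> Prop.
Hypothesis hm : is_max_ideal_Gamma d1 m.
Variable V : lmodType A.
Hypothesis irrV : irreducible_module V.
Variable v : V.
Hypothesis v0 : v != 0.
Hypothesis mv : forall x, m x -> x *: v = 0.

Lemma Wp1_comm x z : Wp1 d1 x -> Wp1 d1 z -> x * z = z * x.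
Proof.
move=> hx; have hr r : (0 < r)%N -> forall x, Wp1 d1 x -> x * d1 r = d1 r * x.
  move=> r0 {hx}x /(_ (fun x => x * d1 r = d1 r * x)); apply.
    split=> [||a b ha hb|a b ha hb|c a ha]; rewrite ?mul0r ?mulr0 ?mul1r ?mulr1 //.
    - by rewrite mulrDl mulrDr ha hb.
    - by rewrite -mulrA hb !mulrA ha.
    - by rewrite -scalerAl -scalerAr ha.
  move=> y [s s0 ->]; have := W_dd hW s r; rewrite /d0.
  by case: s s0 => // s _; case: r r0.
move=> /(_ (fun z => x * z = z * x)); apply; last by move=> y [r r0 ->]; exact: hr.
split=> [||a b ha hb|a b ha hb|c a ha]; rewrite ?mul0r ?mulr0 ?mul1r ?mulr1 //.
- by rewrite mulrDl mulrDr ha hb.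
- by rewrite mulrA ha -!mulrA hb.
- by rewrite -scalerAl -scalerAr ha.
Qed.

(** The centre of W(pi) acts on V by scalars, so on v an element of Gamma acts like an element of
    the commutative algebra generated by the d1's. This brings Gamma / m within reach of
    [generic_freeness]. *)
Lemma Gamma_Wp1 x : Gamma d1 x -> (forall u, Wp1 d1 u -> x * u = u * x) /\
  exists2 u, Wp1 d1 u & ann v (x - u).
Proof.
have [h0 h1 hD hM hZ] : is_subalg (Wp1 d1) by exact: gen_subalg_subalg.
pose S x := (forall u, Wp1 d1 u -> x * u = u * x) /\ exists2 u, Wp1 d1 u & ann v (x - u).
move=> /(_ S); apply.
  split=> [||a b [ca [a' Wa ha]] [cb [b' Wb hb]]|a b [ca [a' Wa ha]] [cb [b' Wb hb]]
      |c a [ca [a' Wa ha]]].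
  - split=> [u _|]; first by rewrite mul0r mulr0.
    by exists 0 => //; rewrite subrr; exact: subspace0 (ann_sub v).
  - split=> [u _|]; first by rewrite mul1r mulr1.
    by exists 1 => //; rewrite subrr; exact: subspace0 (ann_sub v).
  - split=> [u hu|]; first by rewrite mulrDl mulrDr ca // cb.
    exists (a' + b'); first exact: hD.
    by rewrite opprD addrACA; apply: (subspaceD (ann_sub v)).
  - split=> [u hu|]; first by rewrite -mulrA cb // mulrA ca // mulrA.
    exists (a' * b'); first exact: hM.
    have -> : a * b - a' * b' = a * (b - b') + b' * (a - a').
      by rewrite !mulrBr (ca b') // (Wp1_comm Wa Wb); lin k A.
    by apply: (subspaceD (ann_sub v)); exact: ann_mul.
  - split=> [u hu|]; first by rewrite -scalerAl -scalerAr ca.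
    exists (c *: a'); first exact: hZ.
    by rewrite -scalerBr; apply: (subspaceZ (ann_sub v)).
move=> y [[Wy cy]|cy]; split=> [u Wu|].
- exact: cy.
- by exists y => //; rewrite subrr; exact: subspace0 (ann_sub v).
- exact: cy.
- have [c hc] := central_scalar irrV cy; exists c%:A; last exact: hc.
  exact: hZ.
Qed.

Lemma max_ideal_inv x : Gamma d1 x -> ~ m x -> exists2 h, Gamma d1 h & m (1 - h * x).
Proof.
case: hm => -[mG m0 mD mM] m1 mmax Gx nmx; apply: NNPP => nex.
have [G0 G1 GD GM GZ] : is_subalg (Gamma d1) by exact: gen_subalg_subalg.
have mN z : m z -> m (- z) by move=> mz; rewrite -mulN1r -scaleN1r -mulr_algl; apply: mM => //; rewrite mulr1; apply: GZ.
pose J z := exists2 h, Gamma d1 h & m (z - h * x).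
have JP : is_ideal_Gamma d1 J.
  split=> [z [h Gh mz]||z z' [h Gh mz] [h' Gh' mz']|g z Gg [h Gh mz]].
  - by rewrite -[z](subrK (h * x)); apply: GD; [exact: mG|exact: GM].
  - by exists 0; rewrite ?mul0r ?subr0.
  - exists (h + h'); first exact: GD.
    by rewrite mulrDl opprD addrACA; apply: mD.
  - exists (g * h); first exact: GM.
    by rewrite -mulrA -mulrBr; apply: mM.
apply: nmx; apply: (proj1 (mmax J JP _ _ x)).
- by move=> [h Gh mh]; apply: nex; exists h.
- by move=> z mz; exists 0; rewrite ?mul0r ?subr0.
- by exists 1; rewrite ?mul1r ?subrr.
Qed.

Lemma max_ideal_ann x : Gamma d1 x -> ann v x -> m x.
Proof.
move=> Gx vx; apply: NNPP => /(max_ideal_inv Gx)[h Gh /mv].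
rewrite scalerBl scale1r -scalerA vx scaler0 subr0 => ve.
by move: v0; rewrite ve eqxx.
Qed.

Lemma max_ideal_central z : centre_W z -> exists c : k, m (z - c%:A).
Proof.
move=> cz; have [c hc] := central_scalar irrV cz; exists c.
have [G0 G1 GD GM GZ] : is_subalg (Gamma d1) by exact: gen_subalg_subalg.
apply: max_ideal_ann; last exact: hc.
apply: GD; first by move=> S hS hG; apply: hG; right.
by rewrite -scaleNr; apply: GZ.
Qed.

Lemma Gamma_d1 r : (0 < r)%N -> Gamma d1 (d1 r).
Proof.
move=> r0 S hS hG; apply: hG; left.
have Wr : Wp1 d1 (d1 r) by move=> S' _ h; apply: h; exists r.
by split=> // y Wy; exact: Wp1_comm.
Qed.

(** A Nullstellensatz: otherwise every [d1 r] - c would be invertible modulo m, against generic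
    freeness over k[[d1 r]] of the module that [d1 1], ..., [d1 p1] generate from v. These commute,
    so weight 1 serves for all of them. *)
Lemma max_ideal_d1 r : (0 < r)%N -> exists c : k, m (d1 r - c%:A).
Proof.
move=> r0; apply: NNPP => nex; have Gr := Gamma_d1 r0.
have [G0 G1 GD GM GZ] : is_subalg (Gamma d1) by exact: gen_subalg_subalg.
have Wr : Wp1 d1 (d1 r) by move=> S' _ h; apply: h; exists r.
have Gc c : Gamma d1 (d1 r - c%:A).
  by apply: GD => //; rewrite -scaleNr; apply: GZ.
have inv c : exists2 h, Gamma d1 h & m (1 - h * (d1 r - c%:A)).
  by apply: max_ideal_inv => // hc; apply: nex; exists c.
have [W0 W1 WD WM WZ] : is_subalg (Wp1 d1) by exact: gen_subalg_subalg.
have mG x : m x -> Gamma d1 x by case: hm => -[h _ _ _] _ _; exact: h.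
pose y (i : 'I_p1) := d1 i.+1.
have yW i : Wp1 d1 (y i) by move=> S' _ h; apply: h; exists i.+1.
have yc (i j : 'I_p1) : filt y (fun=> 1%N) (1 + 1).-1 (comm (y i) (y j)).
  by rewrite /comm (Wp1_comm (yW i) (yW j)) subrr; exact: filt0.
have tc i : d1 r * y i = y i * d1 r by exact: Wp1_comm.
have w_gt0 (i : 'I_p1) : (0 < 1)%N by [].
apply: (generic_freeness w_gt0 yc tc (ann_sub v) (@ann_mul _ _ _ v)).
- move=> g hg; apply/eqP; apply: contraT => g0.
  suff [_] : Wp1 d1 (peval (d1 r) g) /\ peval (d1 r) g *: v != 0 by rewrite hg eqxx.
  apply: (@peval_prod_neq0 _ _ (d1 r) (fun x => Wp1 d1 x /\ x *: v != 0)) => //.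
  + by case; rewrite scale0r eqxx.
  + move=> c x [Wx xv]; split.
      by apply: WM => //; apply: WD => //; rewrite -scaleNr; apply: WZ.
    have [h Gh mh] := inv c; apply/eqP => e0.
    have [/(_ _ Wx) cx _] := Gamma_Wp1 (mG _ mh).
    have : (x * (1 - h * (d1 r - c%:A))) *: v = 0 by rewrite -scalerA mv // scaler0.
    rewrite -cx mulrBl mul1r scalerBl -mulrA -scalerA e0 scaler0 subr0.
    by move=> xv0; rewrite xv0 eqxx in xv.
  + move=> c x c0 [Wx xv]; split; first exact: WZ.
    apply: contraNneq xv => h; rewrite -[x](scalerK c0) -mulr_algl.
    by rewrite -scalerA h scaler0.
  + by rewrite scale1r.
- move=> c; have [h Gh mh] := inv c; exists h; last first.
    have [/(_ _ Wr) ch _] := Gamma_Wp1 Gh.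
    have -> : (d1 r - c%:A) * h = h * (d1 r - c%:A).
      by rewrite mulrBr mulrBl ch -scalerAl -scalerAr mul1r mulr1.
    exact: mv.
  have [_ [u Wu hu]] := Gamma_Wp1 Gh.
  rewrite -[h](subrK u); apply: (subspaceD (span_sub _ _ (ann_sub v) _)).
    by apply: span_N.
  have [n hn] : exists n, filt y (fun=> 1%N) n u.
    move: Wu => /(_ (fun u => exists n, filt y (fun=> 1%N) n u)); apply.
      split=> [||a b [n ha] [n' hb]|a b [n ha] [n' hb]|a b [n hb]].
      + by exists 0%N; exact: filt0.
      + by exists 0%N; exact: filt1.
      + exists (n + n')%N; apply: (subspaceD (filt_sub _ _ _)).
          by apply: filt_leq ha; rewrite leq_addr.
        by apply: filt_leq hb; rewrite leq_addl.
      + by exists (n + n')%N; apply: filt_mul.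
      + by exists n; apply: (subspaceZ (filt_sub _ _ _)).
    move=> _ [s s0 ->]; have [sp|ps] := leqP s p1; last first.
      exists 0%N; have := W_d1_trunc hW ps; rewrite /d0; case: s s0 {ps} => // s _ /= ->; exact: filt0.
    have hs' : (s.-1 < p1)%N by rewrite prednK.
    exists 1%N; have := filt_gen y (fun=> 1%N) (Ordinal hs').
    by rewrite /y /= prednK.
  rewrite -[u]mulr1 -(peval1 (d1 r)).
  exact: (filt_span w_gt0 yc (d1 r) (ann_sub v) (Q := predT) 1 (fun _ _ => isT) hn).
Qed.

End Scalars.

(** * The fibres *)

(** If some h in m does not kill x, then h x is nonzero and is killed by products with one factor
    fewer. *)
Lemma wspace_killed (k : fieldType) (A : algType k) (m : A -> Prop)
    (V : lmodType A) (x : V) : x != 0 -> in_wspace m x ->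
  exists v : V, v != 0 /\ forall h, m h -> h *: v = 0.
Proof.
move=> x0 [kk]; elim: kk x x0 => [|kk IH] x x0 hx.
  have /eqP := hx (fun=> 0) (fun i => match notF (valP i) with end).
  by rewrite big_ord0 scale1r (negbTE x0).
have [killed|nk] := classic (forall h, m h -> h *: x = 0); first by exists x.
have [h mh hx0] : exists2 h, m h & h *: x != 0.
  apply: NNPP => nex; apply: nk => h mh; apply/eqP; apply: contraT => hx0.
  by case: nex; exists h.
apply: (IH (h *: x) hx0) => g mg.
have := hx (fun i => if unlift ord_max i is Some j then g j else h).
rewrite big_ord_recr /= unlift_none => H; rewrite scalerA -[RHS]H.
  congr (_ * _ *: _); apply: eq_bigr => i _.
  have -> : widen_ord (leqnSn kk) i = lift ord_max i.
    by apply: val_inj; rewrite /= /bump leqNgt ltn_ord.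
  by rewrite liftK.
by move=> i; case: unlift.
Qed.

Theorem theorem8p4 (k : closedFieldType) (hchar : [pchar k] =i pred0)
  (p1 p2 : nat) (hp1 : (0 < p1)%N) (hp12 : (p1 <= p2)%N)
  (A : algType k) (d1 d2 e f : nat -> A)
  (hW : is_W_algebra p1 p2 d1 d2 e f) :
  (* the fiber of every m has at most p1! isomorphism classes *)
  (forall m : A -> Prop, is_max_ideal_Gamma d1 m ->
     forall (n : nat) (V : 'I_n -> lmodType A),
       (forall i, irr_GT_module d1 (V i)) ->
       (forall i, exists x : V i, x != 0 /\ in_wspace m x) ->
       (forall i j, i != j -> ~ isomorphic_modules (V i) (V j)) ->
       (n <= p1`!)%N)
  /\
  (* dim V(m) <= p1! *)
  (forall V : lmodType A, irr_GT_module d1 V ->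
     forall m : A -> Prop, is_max_ideal_Gamma d1 m ->
     forall (n : nat) (v : 'I_n -> V),
       (forall i, in_wspace m (v i)) -> k_lin_indep v -> (n <= p1`!)%N).
Proof.
have [s12 [s21 [hs12 [hrel hgen _]]]] := hW.
have hs : (p1 + s12 + s21 = p2)%N by lia.
have d1_scalars m (hm : is_max_ideal_Gamma d1 m) (V : lmodType A) (v : V) :
    irreducible_module V -> v != 0 -> (forall h, m h -> h *: v = 0) ->
    exists2 a : nat -> k, forall r, (0 < r)%N -> m (d1 r - (a r)%:A) &
      forall n, exists c : k, m (qdet d1 d2 n - c%:A).
  move=> irrV v0 mv.
  have h r : exists c : k, (0 < r)%N -> m (d1 r - c%:A).
    case: r => [|r]; first by exists 0.
    by have [c hc] := max_ideal_d1 hchar hs hrel hgen hm irrV v0 mv (ltn0Sn r); exists c.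
  exists (fun r => proj1_sig (constructive_indefinite_description _ (h r))).
    by move=> r; exact: (proj2_sig (constructive_indefinite_description _ (h r))).
  move=> n; apply: (max_ideal_central hchar hs hrel hgen hm irrV v0 mv).
  exact: (qdet_central hrel hgen).
split.
  move=> m hm n V irrV wV niso; rewrite leqNgt; apply/negP => hn.
  have irr i : irreducible_module (V i) by have [] := irrV i.
  have kv i : exists v : V i, v != 0 /\ forall h, m h -> h *: v = 0.
    by have [x [x0 wx]] := wV i; exact: wspace_killed wx.
  pose v i := proj1_sig (constructive_indefinite_description _ (kv i)).
  have vP i : v i != 0 /\ forall h, m h -> h *: v i = 0.
    exact: (proj2_sig (constructive_indefinite_description _ (kv i))).
  have i0 : 'I_n by exists 0%N; exact: leq_ltn_trans hn.
  have [a ha hq] := d1_scalars m hm _ _ (irr i0) (vP i0).1 (vP i0).2.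
  have den := irreducible_density irr (fun i => (vP i).1) niso.
  have [x hx] := fin_all_exists den.
  (* L is the annihilator of the vector (v i) in the direct sum of the modules, and A / L is that
     direct sum; [x i] represents its component v i, a vector of weight a. *)
  pose L y := forall i, ann (v i) y.
  have hL : subspace L.
    split=> [i|c y z Ly Lz i]; first exact: subspace0 (ann_sub (v i)).
    by apply: (ann_sub (v i)).2; [exact: Ly|exact: Lz].
  have hLm b y : L y -> L (b * y) by move=> Ly i; apply: ann_mul.
  have La r : (0 < r)%N -> L (d1 r - (a r)%:A).
    by move=> r0 i; apply: (vP i).2; exact: ha.
  have Lq l : scalar_mod L (qdet d1 d2 l).
    by have [c hc] := hq l; exists c => i; apply: (vP i).2.
  have Lx i : exists K, forall r, (0 < r)%N -> L ((d1 r - (a r)%:A) ^+ K * x i).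
    exists 1%N => r r0 j; rewrite expr1 /ann -scalerA.
    have [->|ji] := eqVneq j i; last by rewrite (hx i).2 // scaler0.
    by rewrite (hx i).1; apply: (vP i).2; exact: ha.
  have [c [i ci] /(_ i)] := gen_weight_bound hchar hrel hgen hL hLm La Lq hn Lx.
  rewrite /ann scaler_suml (bigD1 i) //= big1 => [|j ji].
    rewrite addr0 -mulr_algl -scalerA (hx i).1 => h0.
    have := (vP i).1; rewrite -[v i]scale1r -[1](_ : (c i)^-1%:A * (c i)%:A = _).
      by rewrite -scalerA h0 scaler0 eqxx.
    by rewrite mulr_algl scalerA mulVf // scale1r.
  by rewrite -mulr_algl -scalerA (hx j).2 ?scaler0 // eq_sym.
move=> V [irrV _] m hm n v wv indep; rewrite leqNgt; apply/negP => hn.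
have i0 : 'I_n by exists 0%N; exact: leq_ltn_trans hn.
have vi0 : v i0 != 0.
  apply/eqP => e0; have := indep (fun i => (i == i0)%:R).
  rewrite (bigD1 i0) //= e0 scaler0 big1 => [|i /negbTE ->]; last by rewrite !scale0r.
  by rewrite addr0 => /(_ erefl i0)/eqP; rewrite eqxx oner_eq0.
have [u [u0 mu]] := wspace_killed vi0 (wv i0).
have [a ha hq] := d1_scalars m hm _ _ irrV u0 mu.
(* V is A modulo the annihilator of u, and [x i] represents v i there. Only u has to be killed by m;
   the v i merely have the generalized weight of u. *)
have [x hx] := fin_all_exists (fun i => irreducible_cyclic irrV u0 (v i)).
have La r : (0 < r)%N -> ann u (d1 r - (a r)%:A) by move=> r0; apply: mu; exact: ha.
have Lq l : scalar_mod (ann u) (qdet d1 d2 l).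
  by have [c hc] := hq l; exists c; apply: mu.
have Lx i : exists K, forall r, (0 < r)%N -> ann u ((d1 r - (a r)%:A) ^+ K * x i).
  have [K hK] := wv i; exists K => r r0; rewrite /ann -scalerA -hx.
  by have := hK (fun=> d1 r - (a r)%:A) (fun=> ha r r0); rewrite prodr_const card_ord.
have [c [i ci]] := gen_weight_bound hchar hrel hgen (ann_sub u) (@ann_mul _ _ _ u) La Lq hn Lx.
rewrite /ann scaler_suml => h0; move: ci; rewrite (indep c) ?eqxx // -[RHS]h0.
by apply: eq_bigr => j _; rewrite hx scalerA mulr_algl.
Qed.
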